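(* Let $\theta>0$, $\lambda\in\mathbb{R}$, and let either $N\geq3$ and $1<p\leq2^\star-1$ with $2^\star=\frac{2N}{N-2}$, or $N=2$ and $1<p<\infty$. Let $u\in H^1(\mathbb{B}^N)$ be a positive radial solution of $$\Delta_{\mathbb{B}^N}u+\lambda u+|u|^{p-1}u+\theta u\ln u^2=0\quad\text{in }\mathbb{B}^N,$$ written as a function $u(\rho)$ of $\rho=d(0,x)$. Then $u'(\rho)<0$ for every $\rho>0$, and $\lim_{\rho\to\infty}u(\rho)=\lim_{\rho\to\infty}u'(\rho)=0$.
   Context: $\mathbb{B}^N$ is the ball model of hyperbolic $N$-space: the Euclidean unit ball with the metric $g=\left(\frac{2}{1-|x|^2}\right)^2dx^2$; $\Delta_{\mathbb{B}^N}$, $\nabla_{\mathbb{B}^N}$, $dV_{\mathbb{B}^N}$ are its Laplace–Beltrami operator, gradient and volume element. $d(0,x)=\ln\frac{1+|x|}{1-|x|}$ is the hyperbolic distance from $0$, and radial means depending only on $d(0,x)$. $H^1(\mathbb{B}^N)$ is the closure of $C_c^\infty(\mathbb{B}^N)$ in the norm $\left(\int_{\mathbb{B}^N}|\nabla_{\mathbb{B}^N}u|_g^2\,dV_{\mathbb{B}^N}\right)^{1/2}$ (it embeds in $L^2(\mathbb{B}^N)$). Solutions are understood weakly (tested against $C_c^\infty(\mathbb{B}^N)$) and are smooth by local elliptic regularity. For radial $u$ the equation reads $$u''(\rho)+\frac{N-1}{\tanh\rho}u'(\rho)+\lambda u(\rho)+u^p(\rho)+\theta u(\rho)\ln u^2(\rho)=0,\qquad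 u'(0)=0.$$ *)

(* Defs.v *)
From HB Require Import structures.
From mathcomp Require Import all_boot all_order all_algebra.
From mathcomp Require Import all_classical all_reals all_analysis.
Set Implicit Arguments.
Unset Strict Implicit.
Unset Printing Implicit Defensive.
Import Order.TTheory GRing.Theory Num.Theory.
Import numFieldNormedType.Exports.
Local Open Scope classical_set_scope.
Local Open Scope ring_scope.

(* Lebesgue measure on R^n, obtained by transporting the iterated product
   measure to [n.-tuple R], which carries the product sigma-algebra. *)
Section lebesgue_tuple.
Context {R : realType}.
Local Notation mR := (measurableTypeR R).

Definition tcons n (p : mR * n.-tuple mR) : n.+1.-tuple mR :=
  [tuple of p.1 :: p.2].

Definition tuncons n (t : n.+1.-tuple mR) : mR * n.-tuple mR :=
  (thead t, [tuple of behead t]).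

Lemma measurable_tcons n : measurable_fun setT (@tcons n).
Proof. exact: measurable_cons. Qed.

Lemma measurable_tuncons n : measurable_fun setT (@tuncons n).
Proof.
apply: measurable_fun_pair; first exact: measurable_tnth.
exact: measurable_behead.
Qed.

Lemma tconsK n : cancel (@tcons n) (@tuncons n).
Proof.
case=> x t; rewrite /tuncons /tcons /= theadE; congr pair.
exact/val_inj.
Qed.

Definition lebesgue_cons n (m : {sigma_finite_measure set (n.-tuple mR) -> \bar R}) :
    set (n.+1.-tuple mR) -> \bar R :=
  pushforward (@lebesgue_measure R \x m)%E (@tcons n).

Section instances.
Variables (n : nat) (m : {sigma_finite_measure set (n.-tuple mR) -> \bar R}).

Let lebesgue_cons_measure :=
  measure_function_pushforward__canonical__measure_function_Measure
    [the {measure set (mR * n.-tuple mR) -> \bar R} of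
      (@lebesgue_measure R \x m)%E] (@measurable_tcons n).

HB.instance Definition _ := isMeasure.Build _ _ _ (lebesgue_cons m)
  (@measure0 _ _ _ lebesgue_cons_measure)
  (@measure_ge0 _ _ _ lebesgue_cons_measure)
  (@measure_semi_sigma_additive _ _ _ lebesgue_cons_measure).

Lemma lebesgue_cons_sigma_finite : sigma_finite setT (lebesgue_cons m).
Proof.
have /sigma_finiteP[F [TF ndF Foo]] := sigma_finiteT (@lebesgue_measure R).
have /sigma_finiteP[G [TG ndG Goo]] := sigma_finiteT m.
exists (fun i => @tuncons n @^-1` (F i `*` G i)).
  rewrite -preimage_bigcup (_ : \bigcup_i _ = setT) ?preimage_setT//.
  rewrite -subTset => -[x t] _.
  have [j _ Fjx] : (\bigcup_i F i) x by rewrite -TF.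
  have [k _ Gkt] : (\bigcup_i G i) t by rewrite -TG.
  exists (maxn j k) => //; split => /=.
  - by move: x Fjx; exact/subsetPset/ndF/leq_maxl.
  - by move: t Gkt; exact/subsetPset/ndG/leq_maxr.
move=> i; have [mF Fi] := Foo i; have [mG Gi] := Goo i; split.
  rewrite -[X in measurable X]setTI; apply: measurable_tuncons => //.
  exact: measurableX.
rewrite /lebesgue_cons /pushforward -comp_preimage.
rewrite (_ : @tuncons n \o @tcons n = id); last exact/funext/tconsK.
by rewrite preimage_id product_measure1E// lte_mul_pinfty// ge0_fin_numE.
Qed.

HB.instance Definition _ := Measure_isSigmaFinite.Build _ _ _
  (lebesgue_cons m) lebesgue_cons_sigma_finite.
End instances.

Fixpoint lebesgue_tuple n : {sigma_finite_measure set (n.-tuple mR) -> \bar R} :=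
  match n with
  | 0 => [the {sigma_finite_measure set (0.-tuple mR) -> \bar R} of
           dirac ([tuple] : 0.-tuple mR)]
  | n'.+1 => [the {sigma_finite_measure set (n'.+1.-tuple mR) -> \bar R} of
               lebesgue_cons (lebesgue_tuple n')]
  end.

End lebesgue_tuple.

Section hyperbolic_ball.
Context {R : realType} {N : nat}.
Implicit Types (x X Y : 'rV[R]_N) (f u phi : 'rV[R]_N -> R)
  (G : 'rV[R]_N -> 'rV[R]_N).

Definition dotp X Y : R := \sum_(i < N) X ord0 i * Y ord0 i.

(* The library norm on ['rV[R]_N] is the sup norm. *)
Definition enorm x : R := Num.sqrt (dotp x x).

Definition uball : set 'rV[R]_N := [set x | enorm x < 1].

Definition conf x : R := 2 / (1 - enorm x ^+ 2).

Definition metric x X Y : R := conf x ^+ 2 * dotp X Y.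

Definition hdist0 x : R := ln ((1 + enorm x) / (1 - enorm x)).

Definition partial (i : 'I_N) f : 'rV[R]_N -> R :=
  fun x => 'D_(delta_mx ord0 i) f x.

Definition egrad f x : 'rV[R]_N := \row_i partial i f x.

(* Gradient for the metric: [metric x (hgrad f x) X = dotp (egrad f x) X]. *)
Definition hgrad f x : 'rV[R]_N := (conf x ^- 2) *: egrad f x.

Definition vec_of_tuple (t : N.-tuple (measurableTypeR R)) : 'rV[R]_N :=
  \row_i tnth t i.

Definition uball_tuple : set (N.-tuple (measurableTypeR R)) :=
  vec_of_tuple @^-1` uball.

(* Integral over the ball against [dV = conf ^ N dx]. *)
Definition hintegral f : \bar R :=
  (\int[lebesgue_tuple N]_(t in uball_tuple)
     (conf (vec_of_tuple t) ^+ N * f (vec_of_tuple t))%:E)%E.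

Definition measurable_on_ball f : Prop :=
  measurable_fun uball_tuple (f \o vec_of_tuple).

Definition smooth f : Prop := forall (s : seq 'I_N),
  let g := foldr partial f s in
  continuous g /\ forall (i : 'I_N) x, derivable g x (delta_mx ord0 i).

(* C_c^infty of the ball, each function being extended by 0 to R^N. *)
Definition test_function phi : Prop :=
  let K := closure [set x | phi x != 0] in
  [/\ smooth phi, compact K & K `<=` uball].

(* [u] belongs to H^1 and [G] is its (metric) gradient. An element of the
   completion of C_c^infty for the gradient norm is identified with its image
   under the embedding into L^2(dV): [u] and [G] are the L^2 limits of
   [phi n] and [hgrad (phi n)] for a sequence of test functions. By the Poincare
   inequality, L^2 convergence of the gradients entails that of the functions. *)
Definition H1_gradient u G : Prop :=
  [/\ measurable_on_ball u,
      (forall i, measurable_on_ball (fun x => G x ord0 i)) &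
      exists phi : nat -> 'rV[R]_N -> R,
        [/\ forall n, test_function (phi n),
            hintegral (fun x => (phi n x - u x) ^+ 2) @[n --> \oo] --> 0%E &
            hintegral (fun x =>
              let W := hgrad (phi n) x - G x in metric x W W)
              @[n --> \oo] --> 0%E]].

Definition H1 u : Prop := exists G, H1_gradient u G.

(* Weak form of Delta u + lambda u + |u|^(p-1) u + theta u ln u^2 = 0; the
   gradient [G] of [u] is unique up to a null set. Both integrands are
   integrable: the first one by the Cauchy-Schwarz inequality, the second one as
   soon as [u] is continuous (or by the Sobolev embedding for subcritical or
   critical [p]). *)
Definition weak_solution (lambda p theta : R) u : Prop :=
  exists2 G, H1_gradient u G &
    forall phi, test_function phi ->
      hintegral (fun x => metric x (G x) (hgrad phi x)) =
      hintegral (fun x =>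
        (lambda * u x + `|u x| `^ (p - 1) * u x + theta * u x * ln (u x ^+ 2))
        * phi x).

End hyperbolic_ball.

(* Main.v *)
Require Import Defs.
From HB Require Import structures.
From mathcomp Require Import all_boot all_order all_algebra.
From mathcomp Require Import all_classical all_reals all_analysis.
From mathcomp Require Import measurable_realfun.
From mathcomp Require Import ring lra.
Set Implicit Arguments.
Unset Strict Implicit.
Unset Printing Implicit Defensive.
Import Order.TTheory GRing.Theory Num.Theory.
Import numFieldNormedType.Exports.
Local Open Scope classical_set_scope.
Local Open Scope ring_scope.

(* In the variable s = |x|^2 a radial solution is a function U(s), and testing
   the equation with eta(|x|^2), where eta' is k times a power of the conformal
   factor, gives a weak first order equation for U in terms of an arbitrary
   k in C_c^oo(0, 1): the H^1 approximation by test functions and the divergence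
   theorem for k(|x|^2) x remove all derivatives of u. Integrals over balls of
   radial functions are differentiable in s because the volume of a ball is
   c s^(n/2), so the lemma of du Bois-Reymond turns this into the formula
   v'(rho) = - sinh(rho)^(1-n) * int_0^rho sinh^(n-1) f(v), with
   f(v) = lambda v + v^p + theta v ln v^2.

   Let F be the primitive of f with F(0) = 0. The energy E = v'^2 / 2 + F(v) is
   nonincreasing, so v' is bounded at infinity; together with v in L^2 this gives
   v -> 0, whence E >= 0 everywhere. As f(c) <= 0 implies F(c) < 0, every critical
   point of v has f(v) > 0, that is v'' < 0; the same holds at the origin, so v'
   starts negative and can never vanish. Finally f(v) < 0 for small v makes v'
   increasing at infinity, and v' -> 0. *)

(** * Derivatives of real functions *)

(** The data are a continuous [u] and a gradient [G] known only as an L^2 limit: neither the radial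
    form of [G] nor any derivative of [u] is available at the start. The choice eta' = k ((1 - s) /
    2)^(n-2) / 2 makes the conformal factors cancel, so that the weighted metric product of the
    gradients of phi and eta(|x|^2) is k(|x|^2) times the Euclidean x . grad phi. Integrating by
    parts then leaves phi alone, and the L^2 convergence of the approximations to [u] is enough. The
    variable s = |x|^2, rather than |x|, keeps radial test functions smooth at the origin. Nothing
    is lost there by taking k supported away from 0: eta is then constant, not zero, near the
    origin, so the formula for v' involves the integral of f(u) over a whole ball. This replaces the
    condition v'(0) = 0. The sign of the energy comes from a linear bound F(c) >= - theta c0 c: once
    v -> 0, a nonincreasing E cannot have been negative. *)

Section Derivation.
Context {R : realType}.
Implicit Types (f g : R -> R) (x a b : R).

Lemma der_eq f x a b : is_derive x 1 f a -> a = b -> is_derive x 1 f b.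
Proof. by move=> ? <-. Qed.

Lemma der_cst x c : is_derive x 1 (fun=> c : R) (0 : R).
Proof. exact: is_derive_cst. Qed.

Lemma der_id x : is_derive x 1 (fun y : R => y) (1 : R).
Proof. exact: is_derive_id. Qed.

Lemma derD f g x a b : is_derive x 1 f a -> is_derive x 1 g b ->
  is_derive x 1 (fun y => f y + g y) (a + b).
Proof. by move=> df dg; exact: is_deriveD. Qed.

Lemma derN f x a : is_derive x 1 f a -> is_derive x 1 (fun y => - f y) (- a).
Proof. by move=> df; exact: is_deriveN. Qed.

Lemma derM f g x a b : is_derive x 1 f a -> is_derive x 1 g b ->
  is_derive x 1 (fun y => f y * g y) (f x * b + g x * a).
Proof. by move=> df dg; exact: is_deriveM. Qed.

Lemma derX f n x a : is_derive x 1 f a ->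
  is_derive x 1 (fun y => f y ^+ n) (n%:R * f x ^+ n.-1 * a).
Proof.
move=> df; have := is_deriveX n df; rewrite (_ : f ^+ n = (fun y => f y ^+ n)) //.
by apply/funext => y; elim: n => // n IHn; rewrite !exprS -IHn.
Qed.

Lemma derV f x a : f x != 0 -> is_derive x 1 f a ->
  is_derive x 1 (fun y => (f y)^-1) (- (f x) ^- 2 * a).
Proof. by move=> f0 df; exact: is_deriveV. Qed.

Lemma der_comp f g x a b : is_derive (g x) 1 f a -> is_derive x 1 g b ->
  is_derive x 1 (fun y => f (g y)) (a * b).
Proof. by move=> df dg; exact: is_derive1_comp. Qed.

Lemma der_expR g x b : is_derive x 1 g b ->
  is_derive x 1 (fun y => expR (g y)) (expR (g x) * b).
Proof. exact: der_comp. Qed.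

Lemma der_ln g x b : 0 < g x -> is_derive x 1 g b ->
  is_derive x 1 (fun y => ln (g y)) ((g x)^-1 * b).
Proof. by move=> gx0 dg; apply: der_comp => //; exact: is_derive1_ln. Qed.

Lemma der_powR g r x b : 0 < g x -> is_derive x 1 g b ->
  is_derive x 1 (fun y => g y `^ r) (r * g x `^ (r - 1) * b).
Proof.
move=> gx0 dg.
exact: (@der_comp (fun z => z `^ r) g x _ b (is_derive1_powR _ gx0) dg).
Qed.

Lemma is_derive_cvg f x a : is_derive x 1 f a -> {for x, continuous f}.
Proof. by move=> df; apply/differentiable_continuous/derivable1_diffP. Qed.

Lemma continuous_eps f x : {for x, continuous f} -> forall e, 0 < e ->
  exists2 d : R, 0 < d & forall y, `|y - x| < d -> `|f y - f x| < e.
Proof.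
move=> /cvgrPdist_lt cf e /cf [d /= d0 H]; exists d => // y yx.
by rewrite distrC H//= distrC.
Qed.

Lemma is_derive_unique f x a b :
  is_derive x 1 f a -> is_derive x 1 f b -> a = b.
Proof. by move=> [_ <-] [_ <-]. Qed.

Lemma is_derive_near f g x a : (\forall y \near x, f y = g y) ->
  is_derive x 1 f a -> is_derive x 1 g a.
Proof. exact: near_eq_is_derive. Qed.

Lemma is_derive_eps f x l :
  (forall e, 0 < e -> exists2 d : R, 0 < d & forall h, h != 0 -> `|h| < d ->
     `|f (x + h) - f x - l * h| <= e * `|h|) -> is_derive x 1 f l.
Proof.
move=> H.
have cv : (h^-1 *: (f (h *: 1 + x) - f x)) @[h --> 0^'] --> l.
  apply/cvgrPdist_le => e e0; have [d d0 Hd] := H e e0.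
  near=> h.
  have h0 : h != 0 by near: h; exact: nbhs_dnbhs_neq.
  have hd : `|h| < d by near: h; apply: dnbhs0_lt.
  have -> : h^-1 *: (f (h *: 1 + x) - f x) = h^-1 * (f (x + h) - f x).
    by rewrite [h *: 1]mulr1 (addrC h).
  rewrite /= distrC -(ler_pM2r (x := `|h|)) ?normr_gt0// -normrM mulrBl.
  by rewrite mulrAC mulVf// mul1r; exact: Hd.
apply: DeriveDef; first by apply/cvg_ex; exists l.
exact/cvg_lim.
Unshelve. all: by end_near. Qed.

Lemma mvt f df a b : a < b ->
  (forall x, a <= x <= b -> is_derive x 1 f (df x)) ->
  exists2 c : R, a < c < b & f b - f a = df c * (b - a).
Proof.
move=> ab H.
have [||c] := @MVT R f df a b ab.
- by move=> x; rewrite in_itv/= => /andP[ax xb]; apply: H; rewrite !ltW.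
- apply: derivable_within_continuous => x; rewrite in_itv/= => /H[].
  by [].
- by rewrite in_itv/= => cab E; exists c.
Qed.

Lemma der_ge0_le f df a b : a <= b ->
  (forall x, a <= x <= b -> is_derive x 1 f (df x)) ->
  (forall x, a <= x <= b -> 0 <= df x) -> f a <= f b.
Proof.
rewrite le_eqVlt => /predU1P[->//|ab] H H0.
have [c /andP[ac cb] E] := mvt ab H.
by rewrite -subr_ge0 E mulr_ge0 ?subr_ge0 ?(ltW ab)// H0// !ltW.
Qed.

Lemma der_le0_ge f df a b : a <= b ->
  (forall x, a <= x <= b -> is_derive x 1 f (df x)) ->
  (forall x, a <= x <= b -> df x <= 0) -> f b <= f a.
Proof.
move=> ab H H0; rewrite -lerN2.
apply: (@der_ge0_le (fun y => - f y) (fun y => - df y)) => // x xab.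
- exact/derN/H.
- by rewrite oppr_ge0 H0.
Qed.

Lemma der_gt0_lt f df a b : a < b ->
  (forall x, a <= x <= b -> is_derive x 1 f (df x)) ->
  (forall x, a < x < b -> 0 < df x) -> f a < f b.
Proof.
move=> ab H H0; have [c cab E] := mvt ab H.
by rewrite -subr_gt0 E mulr_gt0 ?subr_gt0// H0.
Qed.

Lemma der_0_cst f a b : a <= b ->
  (forall x, a <= x <= b -> is_derive x 1 f 0) -> f a = f b.
Proof.
move=> ab H; apply/eqP; rewrite eq_le.
by rewrite (@der_ge0_le f (fun=> 0))// (@der_le0_ge f (fun=> 0)).
Qed.

(** One-sided on purpose: it is applied where information comes from the left of [x], at the first
    zero of [m] and up to the left end of the support of a test function. *)
Lemma der_gt0_left f x l : is_derive x 1 f l -> 0 < l ->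
  exists2 d : R, 0 < d & forall y, x - d < y < x -> f y < f x.
Proof.
move=> [df dfl] l0.
have : (h^-1 *: (f (h *: 1 + x) - f x)) @[h --> 0^'] --> l.
  by rewrite -dfl; exact: df.
move=> /cvgrPdist_lt /(_ _ l0).
rewrite near_withinE => -[d /= d0 H].
exists d => // y /andP[dy yx].
have := H (y - x); rewrite /= sub0r normrN ltr0_norm ?subr_lt0//.
rewrite subr_eq0 lt_eqF// => /(_ _ isT).
rewrite [(y - x) *: 1]mulr1 subrK => H1.
have /H1 : - (y - x) < d by lra.
rewrite [_ *: _]mulrC => H2.
have : 0 < (f y - f x) / (y - x) by move: (ler_norm (l - (f y - f x) / (y - x))); lra.
by rewrite nmulr_lgt0 ?invr_lt0 ?subr_lt0// subr_lt0.
Qed.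

Lemma primitive_oo f a b : a < b ->
  (forall x, {for x, continuous f}) ->
  exists F, forall x, a < x < b -> is_derive x 1 F (f x).
Proof.
move=> ab cf; exists (fun x => \int[lebesgue_measure]_(t in `[a, x]) f t)%R.
move=> x /andP[ax xb].
have fi : lebesgue_measure.-integrable `[a, b] (EFin \o f).
  apply: continuous_compact_integrable; first exact: segment_compact.
  exact: continuous_subspaceT.
have [d E] := continuous_FTC1_closed xb fi ax (cf x).
by apply: DeriveDef; [exact: d|rewrite -derive1E; exact: E].
Qed.

(** Vanishing on the left makes [f] integrable on half-lines, so integration from -oo gives a
    primitive on the whole line, as membership in [Coo] requires. *)
Lemma primitive_left f a : (forall x, {for x, continuous f}) ->
  (forall x, x <= a -> f x = 0) ->
  exists F, forall x, is_derive x 1 F (f x).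
Proof.
move=> cf f0; exists (fun x => \int[lebesgue_measure]_(t in `]-oo, x]) f t)%R.
move=> x.
have fi u : a < u -> lebesgue_measure.-integrable `]-oo, u] (EFin \o f).
  move=> au.
  have : lebesgue_measure.-integrable `[a, u] (EFin \o f).
    apply: continuous_compact_integrable; first exact: segment_compact.
    exact: continuous_subspaceT.
  rewrite integrable_mkcond//= => fi.
  rewrite integrable_mkcond//=.
  apply: eq_integrable fi => // y _; rewrite !patchE !mem_setE !in_itv/=.
  by have [ay|/ltW ya] := leP a y; rewrite //= f0// if_same.
have xu : x < Num.max x a + 1 by rewrite ltr_pwDr// le_max lexx.
have au : a < Num.max x a + 1 by rewrite ltr_pwDr// le_max lexx orbT.
have [d E] := continuous_FTC1 xu (fi _ au) (ltNyr _) (cf x).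
by apply: DeriveDef; [exact: d|rewrite -derive1E; exact: E].
Qed.

End Derivation.

(** Derivatives present in the context are tried before the function is decomposed; [der] leaves the
    equality between the computed and the expected derivative. *)
Ltac der_step := first [ eassumption | eapply der_cst | eapply der_id
  | eapply derD | eapply derN | eapply derM | eapply derX
  | eapply der_expR | eapply der_ln | eapply der_powR | eapply derV ].
Ltac der := eapply der_eq; [repeat der_step | ]; rewrite /= /id/=.

(** * The radial ordinary differential equation *)

Section Profile.
Context {R : realType}.
Variables (theta lambda p : R).
Implicit Types (a b c e r x y : R).
Hypotheses (theta_gt0 : 0 < theta) (p_gt1 : 1 < p).

Definition nonlin (c : R) := c * (lambda + c `^ (p - 1) + 2 * theta * ln c).

Definition potential (c : R) :=
  c ^+ 2 * (lambda / 2 + c `^ (p - 1) / (p + 1) + theta * ln c - theta / 2).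

Lemma nonlin_derive (c : R) : 0 < c -> exists l : R, is_derive c 1 nonlin l.
Proof.
by move=> c0; eexists; rewrite /nonlin; repeat der_step.
Qed.

Lemma potential_derive (c : R) : 0 < c -> is_derive c 1 potential (nonlin c).
Proof.
move=> c0; rewrite /potential; der => //.
rewrite /nonlin.
have -> : c `^ (p - 1) = c * c `^ (p - 1 - 1).
  by rewrite mulr_powRB1 ?ltW// subr_gt0.
rewrite /=; field.
by rewrite [c == 0]gt_eqF// gt_eqF//; move: p_gt1; lra.
Qed.

(** With Q = c^(p-1), f(c) <= 0 means lambda + Q + 2 theta ln c <= 0. Half of this bounds the
    bracket in [potential] by Q (1/(p+1) - 1/2) - theta/2, which is negative because p > 1. *)
Lemma potential_lt0 c : 0 < c -> nonlin c <= 0 -> potential c < 0.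
Proof.
move=> c0; rewrite /nonlin pmulr_rle0// => H.
rewrite /potential pmulr_rlt0 ?exprn_gt0//.
have Q0 : 0 < c `^ (p - 1) by exact: powR_gt0.
have : c `^ (p - 1) / (p + 1) < c `^ (p - 1) / 2.
  by rewrite ltr_pM2l// ltf_pV2 ?posrE; move: p_gt1; lra.
move: theta_gt0; lra.
Qed.

(** The constant c0 absorbs lambda: (lambda - theta)/2 + theta ln c = theta ln (c / c0), and ln x >=
    1 - 1/x. The bound serves twice: it is bounded below in c, and it tends to 0 with c. *)
Lemma potential_ge : exists2 c0 : R, 0 < c0 &
  forall c, 0 < c -> theta * (c ^+ 2 - c0 * c) <= potential c.
Proof.
pose A := lambda / 2 - theta / 2.
exists (expR (- (A / theta))); first exact: expR_gt0.
set c0 := expR _ => c cpos.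
have c0pos : 0 < c0 by exact: expR_gt0.
have lnc : ln c = ln (c / c0) - A / theta.
  by rewrite ln_div ?posrE// expRK opprK addrK.
have le_ln : 1 - c0 / c <= ln (c / c0).
  have : ln (1 + (c0 / c - 1)) <= c0 / c - 1.
    by apply: le_ln1Dx; rewrite ltrBrDl subrr divr_gt0.
  rewrite addrC subrK => H.
  have : ln (c / c0) = - ln (c0 / c) by rewrite -lnV ?posrE ?divr_gt0// invf_div.
  by move=> ->; lra.
have Q0 : 0 <= c `^ (p - 1) / (p + 1).
  by rewrite divr_ge0// ?powR_ge0//; move: p_gt1; lra.
rewrite /potential lnc.
have -> : lambda / 2 + c `^ (p - 1) / (p + 1) + theta * (ln (c / c0) - A / theta)
    - theta / 2 = c `^ (p - 1) / (p + 1) + theta * ln (c / c0).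
  by rewrite /A; set q := _ / (p + 1); field; rewrite gt_eqF.
have -> : theta * (c ^+ 2 - c0 * c) = c ^+ 2 * (theta * (1 - c0 / c)).
  by field; rewrite gt_eqF.
rewrite ler_pM2l ?exprn_gt0//.
have : theta * (1 - c0 / c) <= theta * ln (c / c0) by rewrite ler_pM2l.
by lra.
Qed.

Lemma nonlin_small : exists2 c1 : R, 0 < c1 & forall c, 0 < c < c1 -> nonlin c <= 0.
Proof.
(* Below 1 the power is at most 1, and below the exponential 2 theta ln c <= - (|lambda| + 1), which
   outweighs both other terms. *)
exists (Num.min 1 (expR (- ((`|lambda| + 1) / (2 * theta))))).
  by rewrite lt_min ltr01 expR_gt0.
move=> c /andP[c0]; rewrite lt_min => /andP[c1 cE].
rewrite /nonlin pmulr_rle0//.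
have Q1 : c `^ (p - 1) <= 1.
  rewrite -[leRHS](powRr0 c); apply: ger_powR; first by rewrite c0 ltW.
  by rewrite subr_ge0 ltW.
have : ln c <= - ((`|lambda| + 1) / (2 * theta)).
  by rewrite -(expRK (- _)) ler_ln ?posrE ?expR_gt0// ltW.
rewrite -mulNr ler_pdivlMr ?mulr_gt0// => H.
have := ler_norm lambda.
lra.
Qed.

(** The radial equation without its geometry: [s] stands for sinh^(n-1), [m] for the integral of s
    f(v) from 0, [v0] for v(0), and [P] for the L^2 mass of v, bounded by [B]. The data at the
    origin are limits, since [s] may vanish there. *)
Variables (v m s s' P : R -> R) (v0 K B : R).
Hypothesis dv : forall r, 0 < r -> is_derive r 1 v (- (m r / s r)).
Hypothesis dm : forall r, 0 < r -> is_derive r 1 m (s r * nonlin (v r)).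
Hypothesis ds : forall r, 0 < r -> is_derive r 1 s (s' r).
Hypothesis s_gt0 : forall r, 0 < r -> 0 < s r.
Hypothesis s'_ge0 : forall r, 0 < r -> 0 <= s' r.
Hypothesis v_gt0 : forall r, 0 < r -> 0 < v r.
Hypothesis v0_gt0 : 0 < v0.
Hypothesis v_at0 : forall e, 0 < e ->
  exists2 d : R, 0 < d & forall r, 0 < r < d -> `|v r - v0| < e.
Hypothesis m_at0 : forall e, 0 < e ->
  exists2 d : R, 0 < d & forall r, 0 < r < d -> `|m r| < e.
Hypothesis K_gt0 : 0 < K.
Hypothesis dP : forall r, 0 < r -> is_derive r 1 P (K * s r * v r ^+ 2).
Hypothesis P_le : forall r, 0 < r -> P r <= B.

Let w r := - (m r / s r).
Let E r := w r ^+ 2 / 2 + potential (v r).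

Let dw r : 0 < r -> is_derive r 1 w (- nonlin (v r) - s' r / s r * w r).
Proof.
move=> r0; have := dm r0; have := ds r0 => dsr dmr; have sr := s_gt0 r0.
have sN0 : s r != 0 by rewrite gt_eqF.
rewrite /w; der => //.
by field; rewrite gt_eqF.
Qed.

Let dE r : 0 < r -> is_derive r 1 E (- (s' r / s r) * w r ^+ 2).
Proof.
move=> r0; have := dw r0 => dwr.
have dpot := der_comp (potential_derive (v_gt0 r0)) (dv r0).
by rewrite /E; der; rewrite /= -/(w r); field; rewrite gt_eqF ?s_gt0.
Qed.

Let E_noninc a b : 0 < a -> a <= b -> E b <= E a.
Proof.
move=> a0 ab; apply: (der_le0_ge (df := fun r => - (s' r / s r) * w r ^+ 2)) => // r.
  by move=> /andP[ar _]; apply: dE; exact: lt_le_trans ar.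
move=> /andP[ar _]; have r0 := lt_le_trans a0 ar.
by rewrite mulNr oppr_le0 mulr_ge0 ?sqr_ge0// divr_ge0 ?s'_ge0// ltW// s_gt0.
Qed.

Let s_nondec a b : 0 < a -> a <= b -> s a <= s b.
Proof.
move=> a0 ab; apply: (der_ge0_le (df := s')) => // r /andP[ar _].
  by apply: ds; exact: lt_le_trans ar.
by apply: s'_ge0; exact: lt_le_trans ar.
Qed.

(** [potential] is bounded below, so the energy at 1 controls w^2 afterwards. The added 1 in the
    bound avoids a square root: t <= (t + 1)^2. *)
Let w_bounded : exists2 L : R, 0 < L & forall r, 1 <= r -> `|w r| <= L.
Proof.
have [c0 c0pos Hp] := potential_ge.
pose k := theta * c0 ^+ 2.
have Hk c : 0 < c -> - k <= potential c.
  move=> cpos; apply: le_trans (Hp _ cpos).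
  rewrite /k -mulrN ler_pM2l//.
  have := sqr_ge0 (c - c0 / 2); have := sqr_ge0 c0; rewrite !expr2; lra.
have k0 : 0 < k by rewrite mulr_gt0// exprn_gt0.
have E1 : - k <= E 1 by rewrite /E ler_wpDl ?Hk ?v_gt0// divr_ge0 ?sqr_ge0.
exists (2 * (E 1 + k) + 1); first by lra.
move=> r r1; have r0 := lt_le_trans ltr01 r1.
have := E_noninc ltr01 r1; have := Hk _ (v_gt0 r0); rewrite {1}/E => H1 H2.
have H3 : w r ^+ 2 <= 2 * (E 1 + k) by lra.
rewrite -ler_sqr ?nnegrE//; last by lra.
rewrite real_normK ?num_real//; apply: le_trans H3 _.
set t := _ * _; have t0 : 0 <= t by rewrite /t; lra.
by rewrite expr2; nra.
Qed.

(* [v] is square integrable and Lipschitz at infinity: [v ^ 3] varies at most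
   as much as a multiple of the bounded increasing function [P]. *)
Let v_small e : 0 < e -> exists2 a : R, 1 <= a & forall r, a <= r -> v r <= e.
Proof.
move=> e0; have [L L0 HL] := w_bounded.
pose k := K * s 1.
have k0 : 0 < k by rewrite mulr_gt0// s_gt0.
have dPk r : 1 <= r -> k * v r ^+ 2 <= K * s r * v r ^+ 2.
  by move=> r1; rewrite ler_wpM2r ?sqr_ge0// ler_wpM2l ?(ltW K_gt0)// s_nondec.
(* Chosen so that, for r >= 1, |(v^3)'| = 3 v^2 |w| <= 3 L v^2 = C k v^2 <= C P'. *)
pose C := 3 * L / k.
have C0 : 0 < C by rewrite divr_gt0// mulr_gt0.
have Ck : C * k = 3 * L by rewrite /C divfK// gt_eqF.
have pos r : 1 <= r -> 0 < r by exact: lt_le_trans.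
have var a b : 1 <= a -> a <= b -> v a ^+ 3 - v b ^+ 3 <= C * (P b - P a) /\
    v b ^+ 3 - v a ^+ 3 <= C * (P b - P a).
  move=> a1 ab.
  have bnd r : 1 <= r -> `|3 * v r ^+ 2 * w r| <= C * (K * s r * v r ^+ 2).
    move=> r1; apply: (@le_trans _ _ (C * (k * v r ^+ 2))); last first.
      by rewrite ler_wpM2l ?(ltW C0)// dPk.
    have n0 : 0 <= 3 * v r ^+ 2 by rewrite mulr_ge0// sqr_ge0.
    rewrite [leRHS]mulrA Ck normrM (ger0_norm n0) mulrAC.
    by rewrite ler_wpM2r ?sqr_ge0// ler_wpM2l// HL.
  have dP' r : a <= r <= b -> is_derive r 1 P (K * s r * v r ^+ 2).
    by move=> /andP[ar _]; apply/dP/pos; exact: le_trans ar.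
  have dv' r : a <= r <= b -> is_derive r 1 v (w r).
    by move=> /andP[ar _]; apply/dv/pos; exact: le_trans ar.
  split.
  - have : C * P a + v a ^+ 3 <= C * P b + v b ^+ 3.
      apply: (@der_ge0_le _ (fun r => C * P r + v r ^+ 3)
        (fun r => C * (K * s r * v r ^+ 2) + 3 * v r ^+ 2 * w r) a b ab) => r rab.
        by have := dP' _ rab; have := dv' _ rab => ? ?; der; rewrite /=; ring.
      have r1 : 1 <= r by case/andP: rab => ar _; exact: le_trans ar.
      by have := bnd _ r1; rewrite ler_norml => /andP[]; lra.
    by rewrite mulrBr; lra.
  - have : C * P a - v a ^+ 3 <= C * P b - v b ^+ 3.
      apply: (@der_ge0_le _ (fun r => C * P r - v r ^+ 3)
        (fun r => C * (K * s r * v r ^+ 2) - 3 * v r ^+ 2 * w r) a b ab) => r rab.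
        by have := dP' _ rab; have := dv' _ rab => ? ?; der; rewrite /=; ring.
      have r1 : 1 <= r by case/andP: rab => ar _; exact: le_trans ar.
      by have := bnd _ r1; rewrite ler_norml => /andP[]; lra.
    by rewrite mulrBr; lra.
(* Since C d = e^3 / 4, once P is within d of its supremum, v^3 moves by at most e^3 / 4. *)
pose d := e ^+ 3 / (4 * C).
have d0 : 0 < d by rewrite divr_gt0 ?exprn_gt0// mulr_gt0.
pose S := [set P r | r in [set r | 1 <= r]].
have hS : has_sup S.
  split; first by exists (P 1), 1 => //=.
  by exists B => _ [r /= r1 <-]; apply/P_le/pos.
have [_ [a /= a1 <-] Pa] := sup_adherent d0 hS.
have PS r : 1 <= r -> P r <= sup S.
  by move=> r1; apply: sup_upper_bound => //; exists r.
exists a => // b ab; rewrite leNgt; apply/negP => evb.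
have Cd : C * d = e ^+ 3 / 4 by rewrite /d; field; rewrite gt_eqF.
have Pd r : a <= r -> P r - P a <= d.
  by move=> ar; have := PS _ (le_trans a1 ar); lra.
have eb : e ^+ 3 < v b ^+ 3 by rewrite ltr_pXn2r// nnegrE ltW// (lt_trans e0).
have va : e ^+ 3 * (3 / 4) < v a ^+ 3.
  have [_ H] := var _ _ a1 ab.
  have : C * (P b - P a) <= C * d by rewrite ler_wpM2l ?(ltW C0)// Pd.
  by rewrite Cd; lra.
have e3 : 0 < e ^+ 3 by rewrite exprn_gt0.
have vlow r : a <= r -> e / 2 <= v r.
  move=> ar; have [H _] := var _ _ a1 ar.
  have : C * (P r - P a) <= C * d by rewrite ler_wpM2l ?(ltW C0)// Pd.
  rewrite Cd => H'.
  rewrite -(ler_pXn2r (n := 3))// ?nnegrE ?divr_ge0 ?(ltW e0)//; last first.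
    by rewrite ltW// v_gt0// pos// (le_trans a1).
  by rewrite exprMn; lra.
(* A value v b > e keeps v at least e / 2 from a on, so P grows at rate at least k'; after time T it
   would have gained d + 1, more than the d that is left. *)
pose k' := k * (e / 2) ^+ 2.
have k'0 : 0 < k' by rewrite mulr_gt0// exprn_gt0// divr_gt0.
pose T := (d + 1) / k'.
have T0 : 0 < T by rewrite divr_gt0//; lra.
have : P a - k' * a <= P (a + T) - k' * (a + T).
  apply: (@der_ge0_le _ (fun r => P r - k' * r)
    (fun r => K * s r * v r ^+ 2 - k')) => [|r /andP[ar _]|r /andP[ar _]].
  - by rewrite lerDl ltW.
  - by have := dP (pos _ (le_trans a1 ar)) => ?; der; ring.
  - rewrite subr_ge0; apply: le_trans (dPk _ (le_trans a1 ar)).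
    rewrite /k' ler_pM2l// ler_pXn2r// ?nnegrE ?divr_ge0 ?(ltW e0) ?vlow//.
    by rewrite ltW// v_gt0// pos// (le_trans a1).
have := Pd (a + T); rewrite lerDl (ltW T0) => /(_ isT).
have : k' * T = d + 1 by rewrite /T; field; rewrite gt_eqF.
by rewrite mulrDr; lra.
Qed.

(** A negative value E r would persist as an upper bound for E, whereas for v small enough
    [potential_ge] gives E >= - theta c0 v >= (E r) / 2. *)
Let E_ge0 r : 0 < r -> 0 <= E r.
Proof.
move=> r0; rewrite leNgt; apply/negP => Er.
have [c0 c0pos Hp] := potential_ge.
have tc0 : 0 < theta * c0 by rewrite mulr_gt0.
have e0 : 0 < - E r / (2 * (theta * c0)) by rewrite divr_gt0 ?oppr_gt0// mulr_gt0.
have [a a1 Ha] := v_small e0.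
pose b := Num.max a r.
have rb : r <= b by rewrite le_max lexx orbT.
have b0 := lt_le_trans r0 rb.
have := Ha b; rewrite le_max lexx => /(_ isT).
rewrite ler_pdivlMr ?mulr_gt0// => vb.
have := E_noninc r0 rb; rewrite {1}/E => H1.
have := Hp _ (v_gt0 b0); rewrite mulrBr => H2.
have := sqr_ge0 (w b); have : 0 <= theta * v b ^+ 2.
  by rewrite mulr_ge0 ?sqr_ge0 ?ltW.
by move: vb H1 H2; rewrite mulrA; lra.
Qed.

Let crit r : 0 < r -> m r = 0 -> 0 < nonlin (v r).
Proof.
move=> r0 mr; rewrite ltNge; apply/negP => /(potential_lt0 (v_gt0 r0)) H.
by have := E_ge0 r0; rewrite /E /w mr mul0r oppr0 expr0n mul0r add0r leNgt H.
Qed.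

(** The quotient m / s could be 0/0 at the origin. As f(v) is bounded by C there and s is
    nondecreasing, the mean value theorem between a and r, with a -> 0, gives |m r| <= C r s(r). *)
Let w_at0 e : 0 < e -> exists2 d : R, 0 < d & forall r, 0 < r < d -> `|w r| < e.
Proof.
move=> e0.
have [l dn] := nonlin_derive v0_gt0.
have [d1 d10 H1] := continuous_eps (is_derive_cvg dn) ltr01.
have [d2 d20 H2] := v_at0 d10.
pose C := `|nonlin v0| + 1.
have C0 : 0 < C by rewrite ltr_wpDl.
have bnd r : 0 < r < d2 -> `|nonlin (v r)| <= C.
  move=> /H2/H1 /ltW H; rewrite /C.
  by have := ler_normD (nonlin (v r) - nonlin v0) (nonlin v0); rewrite subrK; lra.
have wC r : 0 < r < d2 -> `|w r| <= C * r.
  move=> /andP[r0 rd].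
  suff : `|m r| <= C * r * s r.
    by rewrite /w normrN normrM normfV (gtr0_norm (s_gt0 r0)) ler_pdivrMr ?s_gt0.
  apply/ler_addgt0Pr => t t0.
  have [d3 d30 H3] := m_at0 t0.
  pose a := Num.min r d3 / 2.
  have mn0 : 0 < Num.min r d3 by rewrite lt_min r0.
  have a0 : 0 < a by rewrite divr_gt0.
  have ar : a < r by have : Num.min r d3 <= r by [rewrite ge_min lexx]; rewrite /a; lra.
  have ad : a < d3.
    by have : Num.min r d3 <= d3 by [rewrite ge_min lexx orbT]; rewrite /a; lra.
  have [|c /andP[ac cr] Ec] := mvt (f := m) (df := fun x => s x * nonlin (v x)) ar.
    by move=> x /andP[ax _]; apply: dm; exact: lt_le_trans ax.
  have c0 := lt_trans a0 ac.
  have ma : `|m a| < t by rewrite H3// a0.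
  have ra0 : 0 < r - a by rewrite subr_gt0.
  have -> : m r = m a + s c * nonlin (v c) * (r - a) by rewrite -Ec addrC subrK.
  apply: le_trans (ler_normD _ _) _; rewrite addrC lerD//; last exact: ltW.
  rewrite normrM (gtr0_norm ra0) normrM (gtr0_norm (s_gt0 c0)).
  have H4 : `|nonlin (v c)| <= C by rewrite bnd// c0 (lt_trans cr).
  have H5 : s c <= s r by rewrite s_nondec// ltW.
  have -> : C * r * s r = s r * C * r by ring.
  apply: ler_pM => //.
  - by rewrite mulr_ge0// ltW// s_gt0.
  - exact: ltW.
  - by apply: ler_pM => //; rewrite ltW// s_gt0.
  - by rewrite gerBl ltW.
exists (Num.min d2 (e / C)); first by rewrite lt_min d20 divr_gt0.
move=> r /andP[r0]; rewrite lt_min => /andP[rd re].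
apply: le_lt_trans (wC _ _) _; first by rewrite r0.
by move: re; rewrite ltr_pdivlMr// mulrC.
Qed.

(** As w -> 0, the energy tends to F(v0) at the origin; E >= 0 is then incompatible with F(v0) <
    0. *)
Let nonlin_v0 : 0 < nonlin v0.
Proof.
rewrite ltNge; apply/negP => /(potential_lt0 v0_gt0) H.
pose t := - potential v0 / 2.
have t0 : 0 < t by rewrite divr_gt0// oppr_gt0.
have [d1 d10 H1] := continuous_eps (is_derive_cvg (potential_derive v0_gt0)) t0.
have [d2 d20 H2] := v_at0 d10.
(* The minimum with 1 gives w^2 <= |w| < t. *)
have e0 : 0 < Num.min 1 t by rewrite lt_min ltr01.
have [d3 d30 H3] := w_at0 e0.
pose r := Num.min d2 d3 / 2.
have mn0 : 0 < Num.min d2 d3 by rewrite lt_min d20.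
have r0 : 0 < r by rewrite divr_gt0.
have r2 : r < d2.
  by have : Num.min d2 d3 <= d2 by [rewrite ge_min lexx]; rewrite /r; lra.
have r3 : r < d3.
  by have : Num.min d2 d3 <= d3 by [rewrite ge_min lexx orbT]; rewrite /r; lra.
have := H1 (v r); rewrite H2 ?r0// => /(_ isT); rewrite ltr_norml => /andP[_ Hp].
have := H3 r; rewrite r0 r3 lt_min => /(_ isT)/andP[w1 wt].
have : w r ^+ 2 <= `|w r|.
  by rewrite -real_normK ?num_real// expr2 ler_piMl// ltW.
have := E_ge0 r0; rewrite /E; move: Hp wt; rewrite /t; lra.
Qed.

(** Near the origin f(v) > 0, so m is strictly increasing there. Its limit 0 gives m (r/2) >= 0, and
    the step from r/2 to r makes the sign strict. *)
Let m_pos_near0 : exists2 d : R, 0 < d & forall r, 0 < r < d -> 0 < m r.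
Proof.
have [l dn] := nonlin_derive v0_gt0.
have [d1 d10 H1] := continuous_eps (is_derive_cvg dn) nonlin_v0.
have [d d0 H2] := v_at0 d10; exists d => // r /andP[r0 rd].
have npos x : 0 < x < d -> 0 < nonlin (v x).
  by move=> /H2/H1; rewrite ltr_norml => /andP[]; lra.
have mono a b : 0 < a -> a < b -> b < d -> m a < m b.
  move=> a0 ab bd.
  apply: (der_gt0_lt (df := fun x => s x * nonlin (v x))) => // x /andP[ax xb].
    by apply: dm; exact: lt_le_trans ax.
  have x0 := lt_trans a0 ax.
  by rewrite mulr_gt0 ?s_gt0 ?npos// x0 (lt_trans xb).
have h0 : 0 < r / 2 by rewrite divr_gt0.
have hr : r / 2 < r by lra.
apply: le_lt_trans (mono _ _ h0 hr rd).
rewrite leNgt; apply/negP => mh.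
have [|d3 d30 H3] := @m_at0 (- m (r / 2)); first by rewrite oppr_gt0.
pose a := Num.min (r / 2) d3 / 2.
have mn0 : 0 < Num.min (r / 2) d3 by rewrite lt_min h0.
have a0 : 0 < a by rewrite divr_gt0.
have ar : a < r / 2.
  by have : Num.min (r / 2) d3 <= r / 2 by [rewrite ge_min lexx]; rewrite /a; lra.
have ad : a < d3.
  by have : Num.min (r / 2) d3 <= d3 by [rewrite ge_min lexx orbT]; rewrite /a; lra.
have := H3 a; rewrite a0 ad ltr_norml opprK => /(_ isT)/andP[+ _].
by rewrite ltNge ltW// mono// (lt_trans hr).
Qed.

(* At the first zero of [m] the derivative of [m] would be positive. *)
Let m_pos r : 0 < r -> 0 < m r.
Proof.
have [d d0 Hd] := m_pos_near0.
move=> r0; rewrite ltNge; apply/negP => mr.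
(* Searching for a zero from d / 2 on, where m > 0 is known, keeps the infimum c away from the
   singular origin. *)
pose a := d / 2; have a0 : 0 < a by rewrite divr_gt0.
have ad : a < d by rewrite /a; lra.
pose A := [set x | a <= x /\ m x <= 0].
have ra : a <= r.
  by rewrite leNgt; apply/negP => ra; move: mr; rewrite leNgt Hd// r0 (lt_trans ra).
have hA : has_inf A by split; [exists r|exists a => x []].
pose c := inf A.
have ac : a <= c by apply: lb_le_inf; [exists r|move=> x []].
have c0 := lt_le_trans a0 ac.
have Ac x : a <= x -> x < c -> 0 < m x.
  move=> ax xc; rewrite ltNge; apply/negP => mx.
  by move: xc; rewrite ltNge; apply/negP/negPn; apply: ge_inf; [case: hA|split].
have cm := is_derive_cvg (dm c0).
(* If m c < 0, points just to the left of c would already belong to A; if m c > 0, A would have no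
   points near its infimum. *)
have mc : m c = 0.
  apply/eqP; case: (ltrgtP (m c) 0) => // mc; exfalso.
  - have [|e e0 He] := continuous_eps cm (_ : 0 < - m c); first by rewrite oppr_gt0.
    have ca : a < c.
      rewrite lt_neqAle ac andbT; apply/eqP => E'.
      by move: mc; rewrite -E' ltNge ltW// Hd// a0.
    pose x := Num.max a (c - e / 2).
    have xc : x < c by rewrite gt_max ca /=; lra.
    have ax : a <= x by rewrite le_max lexx.
    have := He x; rewrite ltr0_norm ?subr_lt0//.
    have : c - e / 2 <= x by rewrite le_max lexx orbT.
    move=> H1 H2; have /H2 : - (x - c) < e by lra.
    by rewrite ltr_norml => /andP[_]; have := Ac _ ax xc; lra.
  - have [e e0 He] := continuous_eps cm mc.
    have [x [ax mx] xc] := inf_adherent e0 hA.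
    have cx : c <= x by apply: ge_inf; [case: hA|split].
    have := He x; rewrite ger0_norm ?subr_ge0//.
    have -> : x - c < e by move: xc; rewrite -/c; lra.
    by move=> /(_ isT); rewrite ltr_norml => /andP[]; lra.
have [|e e0 He] := der_gt0_left (dm c0).
  by rewrite mulr_gt0 ?s_gt0 ?crit.
have ca : a < c.
  rewrite lt_neqAle ac andbT; apply/eqP => E'.
  by have := Hd a; rewrite a0 ad E' mc ltxx => /(_ isT).
pose x := Num.max a (c - e / 2).
have xc : x < c by rewrite gt_max ca /=; lra.
have ax : a <= x by rewrite le_max lexx.
have : c - e / 2 <= x by rewrite le_max lexx orbT.
move=> H1; have := He x; rewrite xc mc.
have -> : c - e < x by lra.
by move=> /(_ isT); have := Ac _ ax xc; lra.
Qed.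

Let w_lt0 r : 0 < r -> w r < 0.
Proof. by move=> r0; rewrite oppr_lt0 divr_gt0 ?s_gt0 ?m_pos. Qed.

Let w_small e : 0 < e -> exists2 a : R, 1 <= a & forall r, a <= r -> - e <= w r.
Proof.
move=> e0; have [c1 c10 Hc] := nonlin_small.
have [|a a1 Ha] := @v_small (c1 / 2); first by rewrite divr_gt0.
have pos r : a <= r -> 0 < r by move=> ar; apply: lt_le_trans ar; lra.
have mono x y : a <= x -> x <= y -> w x <= w y.
  move=> ax xy.
  apply: (der_ge0_le (df := fun r => - nonlin (v r) - s' r / s r * w r)) => // r.
    by move=> /andP[xr _]; apply/dw/pos; exact: le_trans xr.
  move=> /andP[xr _]; have ar := le_trans ax xr; have r0 := pos _ ar.
  have H1 : nonlin (v r) <= 0 by apply: Hc; rewrite v_gt0//=; have := Ha _ ar; lra.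
  have H2 : s' r / s r * w r <= 0.
    by rewrite mulr_ge0_le0 ?divr_ge0 ?s'_ge0 ?ltW ?w_lt0// s_gt0.
  lra.
(* From a on, w is nondecreasing, so one value at least - e suffices. Otherwise v decreases at rate
   e or more and is negative at a + T, with T = (v a + 1) / e. *)
have [[b ab wb]|H] := pselect (exists2 b : R, a <= b & - e <= w b).
  exists b; first exact: le_trans ab.
  by move=> r br; apply: le_trans wb _; exact: mono.
exfalso; pose T := (v a + 1) / e.
have T0 : 0 < T by rewrite divr_gt0// ltr_wpDl// ltW// v_gt0// pos.
have : v (a + T) + e * (a + T) <= v a + e * a.
  apply: (@der_le0_ge _ (fun r => v r + e * r) (fun r => w r + e)) => //.
  - by rewrite lerDl ltW.
  - by move=> r /andP[ar _]; have := dv (pos _ ar) => ?; der; rewrite /w; ring.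
  - move=> r /andP[ar _]; rewrite leNgt; apply/negP => H'; apply: H; exists r => //.
    by lra.
have : e * T = v a + 1 by rewrite /T; field; rewrite gt_eqF.
have := v_gt0 (pos (a + T) _); rewrite lerDl (ltW T0) => /(_ isT).
by rewrite mulrDr; lra.
Qed.

Lemma profile_decreasing_vanishing :
  [/\ forall r, 0 < r -> - (m r / s r) < 0,
      v r @[r --> +oo] --> (0 : R) & - (m r / s r) @[r --> +oo] --> (0 : R)].
Proof.
split; first exact: w_lt0.
- apply/cvgrPdist_le => e e0; have [a a1 Ha] := v_small e0.
  near=> r; have ar : a <= r by near: r; apply: nbhs_pinfty_ge; rewrite num_real.
  by rewrite sub0r normrN gtr0_norm ?Ha// v_gt0//; lra.
- apply/cvgrPdist_le => e e0; have [a a1 Ha] := w_small e0.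
  near=> r; have ar : a <= r by near: r; apply: nbhs_pinfty_ge; rewrite num_real.
  have r0 : 0 < r by lra.
  rewrite sub0r normrN -/(w r) ltr0_norm ?w_lt0//.
  by rewrite lerNl; exact: Ha.
Unshelve. all: by end_near. Qed.

End Profile.

(** * Test functions on the line *)

Section Smooth.
Context {R : realType}.
Implicit Types (f g : R -> R) (n : nat) (e x : R).

Fixpoint Ck n f : Prop :=
  if n is n'.+1 then
    exists2 f' : R -> R, (forall x : R, is_derive x 1 f (f' x)) & Ck n' f'
  else True.

Definition Coo f := forall n, Ck n f.

Lemma CkS n f : Ck n.+1 f -> Ck n f.
Proof.
elim: n f => // n IHn f [f' df Hf'].
by exists f' => //; exact: IHn.
Qed.

Lemma Ck_cst n (c : R) : Ck n (fun=> c).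
Proof.
elim: n c => // n IHn c; exists (fun=> 0) => // x; exact: der_cst.
Qed.

Lemma Ck_id n : Ck n (fun x : R => x).
Proof.
case: n => // n; exists (fun=> 1); [exact: der_id|exact: Ck_cst].
Qed.

Lemma CkD n f g : Ck n f -> Ck n g -> Ck n (fun x => f x + g x).
Proof.
elim: n f g => // n IHn f g [f' df Hf] [g' dg Hg].
exists (fun x => f' x + g' x); last exact: IHn.
by move=> x; apply: derD.
Qed.

Lemma CkM n f g : Ck n f -> Ck n g -> Ck n (fun x => f x * g x).
Proof.
elim: n f g => // n IHn f g Hf Hg.
have Hf1 := CkS Hf; have Hg1 := CkS Hg.
case: Hf Hg => [f' df Hf] [g' dg Hg].
exists (fun x => f x * g' x + g x * f' x); last by apply: CkD; exact: IHn.
by move=> x; apply: derM.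
Qed.

Lemma CkX n f m : Ck n f -> Ck n (fun x => f x ^+ m).
Proof.
move=> Hf; elim: m => [|m IHm].
  by rewrite (_ : (fun x => _) = (fun=> 1)); [exact: Ck_cst|].
rewrite (_ : (fun x => _) = (fun x => f x * f x ^+ m)); first exact: CkM.
by apply/funext => x; rewrite exprS.
Qed.

Lemma Ck_affine n f (c d : R) : Ck n f -> Ck n (fun x => f (c * x + d)).
Proof.
elim: n f => // n IHn f [f' df Hf].
exists (fun x => f' (c * x + d) * c).
  move=> x; apply: der_comp (df _) _.
  by der; ring.
by apply: CkM; [exact: IHn|exact: Ck_cst].
Qed.

Lemma Coo_primitive f f' : (forall x, is_derive x 1 f (f' x)) ->
  Coo f' -> Coo f.
Proof. by move=> df Hf [|n] //; exists f'. Qed.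

Lemma Coo_derive f f' : (forall x, is_derive x 1 f (f' x)) ->
  Coo f -> Coo f'.
Proof.
move=> df Hf n; have [g dg Hg] := Hf n.+1.
rewrite (_ : f' = g)//; apply/funext => x; exact: is_derive_unique (df x) (dg x).
Qed.

Lemma Coo_is_derive f : Coo f -> exists2 f', (forall x, is_derive x 1 f (f' x)) & Coo f'.
Proof.
move=> Hf; have [f' df _] := Hf 1; exists f' => //; exact: Coo_derive df Hf.
Qed.

Lemma Coo_continuous f : Coo f -> continuous f.
Proof. by move=> /Coo_is_derive[f' df _] x; exact: is_derive_cvg (df x). Qed.

(** The functions x^-m exp(-1/x), extended by 0. Indexing by m gives a family whose derivatives are
    linear combinations of its members, so smoothness is an induction. *)
Definition flat (m : nat) (x : R) : R :=
  if 0 < x then x ^- m * expR (- x^-1) else 0.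

(** One term of the exponential series gives exp(1/x) >= x^-(m+2) / (m+2)!. The quadratic decay
    yields the derivative 0 at the origin. *)
Lemma flat_bound m x : 0 < x -> flat m x <= (m.+2)`!%:R * x ^+ 2.
Proof.
move=> x0; rewrite /flat x0.
have xi0 : 0 < x^-1 by rewrite invr_gt0.
have H : x^-1 ^+ m.+2 / (m.+2)`!%:R <= expR x^-1.
  by apply: le_trans (expR_ge1Dxn m.+1 (ltW xi0)); rewrite lerDr.
have f0 : 0 < (m.+2)`!%:R :> R by rewrite ltr0n fact_gt0.
have xm : 0 < x ^+ m by rewrite exprn_gt0.
rewrite expRN ler_pdivrMr ?expR_gt0// -[x ^- m]mul1r ler_pdivrMr//.
rewrite ler_pdivrMr// in H.
have E1 : 1 = x^-1 ^+ m.+2 * (x ^+ 2 * x ^+ m).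
  by rewrite -exprD add2n -exprMn mulVf ?gt_eqF// expr1n.
rewrite [leLHS]E1; set a := _ ^+ _ in H *; set F := _%:R in H *.
have -> : F * x ^+ 2 * expR x^-1 * x ^+ m =
  (expR x^-1 * F) * (x ^+ 2 * x ^+ m) by ring.
by rewrite ler_pM2r// mulr_gt0// exprn_gt0.
Qed.

Lemma flat_ge0 m x : 0 <= flat m x.
Proof.
rewrite /flat; case: ifPn => // x0.
by rewrite mulr_ge0 ?expR_ge0// invr_ge0 exprn_ge0// ltW.
Qed.

Lemma flat_derive m x :
  is_derive x 1 (flat m) (flat m.+2 x - m%:R * flat m.+1 x).
Proof.
have [x0|x0|->] := ltgtP x 0.
- rewrite /flat ltNge (ltW x0)/= mulr0 subr0.
  apply: (is_derive_near (f := fun=> 0)).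
  near=> y; rewrite ltNge ifF//; apply/negbF/ltW; near: y.
  exact: lt_nbhsl.
- apply: (is_derive_near (f := fun y => (y ^+ m)^-1 * expR (- y^-1))).
    near=> y; rewrite /flat ifT//; near: y; exact: lt_nbhsr.
  have xN : x != 0 by rewrite gt_eqF.
  have xmN : x ^+ m != 0 by rewrite expf_neq0.
  rewrite /flat x0.
  der => //.
  case: m xmN => [|m] xmN /=.
    by rewrite !mul0r expr0 invr1; field.
  by rewrite !exprS; field; rewrite expf_neq0.
- rewrite /flat ltxx mulr0 subr0.
  apply: is_derive_eps => e e0.
  have f0 : 0 < (m.+2)`!%:R :> R by rewrite ltr0n fact_gt0.
  exists (e / (m.+2)`!%:R); first by rewrite divr_gt0.
  move=> h hN; rewrite ltr_pdivlMr// => hd.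
  rewrite add0r mul0r -/(flat m h) -/(flat m 0) {2}/flat ltxx !subr0.
  rewrite ger0_norm ?flat_ge0//.
  have [h0|h0] := ltP 0 h; last first.
    by rewrite /flat ltNge h0/= mulr_ge0// ltW.
  apply: le_trans (flat_bound m h0) _.
  rewrite gtr0_norm// in hd *.
  by rewrite expr2 mulrA ler_pM2r// mulrC ltW.
Unshelve. all: by end_near. Qed.

Lemma flat_Ck n m : Ck n (flat m).
Proof.
elim: n m => // n IHn m.
exists (fun x => flat m.+2 x + (- m%:R) * flat m.+1 x).
  by move=> x; rewrite mulNr; exact: flat_derive.
by apply: CkD => //; apply: CkM => //; exact: Ck_cst.
Qed.

Lemma flat_gt0 m x : 0 < x -> 0 < flat m x.
Proof. by move=> x0; rewrite /flat x0 mulr_gt0 ?expR_gt0// invr_gt0 exprn_gt0. Qed.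

(** For e > 0, positive exactly on ]-e, e[. The arguments are spelled as affine maps to match
    [Ck_affine]. *)
Definition bump (e x : R) : R := flat 0 (1 * x + e) * flat 0 ((-1) * x + e).

Lemma bump_Coo e : Coo (bump e).
Proof. by move=> n; apply: CkM; apply: Ck_affine; exact: flat_Ck. Qed.

Lemma bump_ge0 e x : 0 <= bump e x.
Proof. by rewrite mulr_ge0 ?flat_ge0. Qed.

Lemma bump_gt0 e : 0 < e -> 0 < bump e 0.
Proof. by move=> e0; rewrite mulr_gt0// flat_gt0// mulr0 add0r. Qed.

Lemma bump_eq0 e x : e <= `|x| -> bump e x = 0.
Proof.
rewrite ler_normr => /orP[ex|ex]; rewrite /bump /flat.
  by rewrite [X in _ * X]ifF ?mulr0//; apply/negbTE; rewrite -leNgt; lra.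
by rewrite ifF ?mul0r//; apply/negbTE; rewrite -leNgt; lra.
Qed.

End Smooth.

(** * The lemma of du Bois-Reymond on an interval *)

Section DuBoisReymond.
Context {R : realType}.
Implicit Types (A B C k F : R -> R) (x : R).

Let clamp (l r x : R) := Num.max l (Num.min r x).

Let clamp_continuous l r : continuous (clamp l r).
Proof.
move=> x; apply: continuous_max; first exact: cst_continuous.
by apply: continuous_min; [exact: cst_continuous|].
Qed.

(** Precomposition with the clamp to [l, r] extends [f] continuously to the line and leaves it
    unchanged on [l, r]. *)
Lemma primitive_within (l r : R) (f : R -> R) : l < r ->
  (forall x, l <= x <= r -> {for x, continuous f}) ->
  exists F, forall x, l < x < r -> is_derive x 1 F (f x).
Proof.
move=> lr cf.
have cE x : l <= x <= r -> clamp l r x = x.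
  by move=> /andP[lx xr]; rewrite /clamp (min_idPr xr) (max_idPr lx).
have [|F HF] := @primitive_oo _ (f \o clamp l r) _ _ lr.
  move=> x; apply: continuous_comp; first exact: clamp_continuous.
  apply: cf; rewrite /clamp le_max lexx/= ge_max (ltW lr) /=.
  by rewrite ge_min lexx.
exists F => x /andP[lx xr]; have := HF x; rewrite lx xr => /(_ isT).
by rewrite /= cE// !ltW.
Qed.

(* [A' = B] as soon as [A k' + B k] has a vanishing primitive for all test
   functions [k]: subtracting a primitive of [B] reduces to [B = 0], and then
   testing with a primitive [k] of a difference of two bumps shows that [A] takes
   the same value at any two points. *)
Lemma du_bois_reymond (A B : R -> R) (l r : R) :
  (forall x, l < x < r -> {for x, continuous A}) ->
  (forall x, l < x < r -> {for x, continuous B}) ->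
  (forall (k k' : R -> R) (a b : R), l < a -> a < b -> b < r ->
     Coo k -> (forall x, is_derive x 1 k (k' x)) ->
     (forall x, ~~ (a < x < b) -> k x = 0) ->
     exists F, (forall x, a <= x <= b -> is_derive x 1 F (A x * k' x + B x * k x))
            /\ F a = F b) ->
  forall x, l < x < r -> is_derive x 1 A (B x).
Proof.
move=> cA cB H x0 /andP[lx0 x0r].
(* Nested intervals: B gets a primitive C on ]l2, r2[, so that D = A - C is continuous on the
   smaller closed interval [l1, r1]. *)
pose l1 := (l + x0) / 2; pose r1 := (x0 + r) / 2.
pose l2 := (l + l1) / 2; pose r2 := (r1 + r) / 2.
have ll2 : l < l2 by rewrite /l2 /l1; lra.
have l21 : l2 < l1 by rewrite /l2 /l1; lra.
have r12 : r1 < r2 by rewrite /r2 /r1; lra.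
have r2r : r2 < r by rewrite /r2 /r1; lra.
have lx : l1 < x0 by rewrite /l1; lra.
have xr : x0 < r1 by rewrite /r1; lra.
clearbody l2 r2 l1 r1.
have [|x /andP[? ?]|C HC] := @primitive_within l2 r2 B.
- by lra.
- by apply: cB; lra.
pose D x := A x - C x.
have cD x : l1 <= x <= r1 -> {for x, continuous D}.
  move=> /andP[? ?]; apply: continuousB; first by apply: cA; lra.
  by apply: is_derive_cvg (HC _ _); lra.
(* The sign s = 1 or -1 handles both strict inequalities between D a and D b. *)
have key s a b : s ^+ 2 = 1 -> l1 < a < r1 -> l1 < b < r1 -> ~ s * D a < s * D b.
  move=> s2 /andP[la ar] /andP[lb br] Dab.
  pose mid := (s * D a + s * D b) / 2.
  have csD y : l1 <= y <= r1 -> {for y, continuous (fun y => s * D y)}.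
    by move=> yl; apply: continuousM; [exact: cst_continuous|exact: cD].
  have ma : 0 < mid - s * D a by rewrite /mid; lra.
  have mb : 0 < s * D b - mid by rewrite /mid; lra.
  have alr : l1 <= a <= r1 by rewrite !ltW.
  have blr : l1 <= b <= r1 by rewrite !ltW.
  have [e1 e10 He1] := continuous_eps (csD a alr) ma.
  have [e2 e20 He2] := continuous_eps (csD b blr) mb.
  (* Bumps of radius e < m1 stay inside ]l1, r1[; the one around a sees only s D < mid, the one
     around b only s D > mid. *)
  pose m1 := Num.min (Num.min e1 e2) (Num.min (Num.min (a - l1) (b - l1))
     (Num.min (r1 - a) (r1 - b))).
  have m0 : 0 < m1 by rewrite !lt_min e10 e20 !subr_gt0 la lb ar br.
  have [me1 me2] : m1 <= e1 /\ m1 <= e2 by rewrite /m1 !ge_min !lexx !orbT.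
  have [mla mlb mra mrb] : [/\ m1 <= a - l1, m1 <= b - l1, m1 <= r1 - a & m1 <= r1 - b].
    by rewrite /m1 !ge_min !lexx !orbT.
  clearbody m1.
  pose e := m1 / 2; have e0 : 0 < e by rewrite divr_gt0.
  have em : e < m1 by rewrite /e; lra.
  clearbody e.
  have [x|x xe|Q HQ] := @primitive_left _ (bump e) (- e).
  - exact: Coo_continuous (bump_Coo e) _.
  - by rewrite bump_eq0// ler_normr; apply/orP; right; lra.
  have QC : Coo Q by apply: Coo_primitive HQ (bump_Coo e).
  have Ql x : x <= - e -> Q x = Q (- e).
    move=> xe; apply: (der_0_cst xe) => y /andP[_ ye].
    by apply: der_eq (HQ y) _; rewrite bump_eq0// ler_normr; apply/orP; right; lra.
  have Qr x : e <= x -> Q x = Q e.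
    move=> ex; apply/esym/(der_0_cst ex) => y /andP[ye _].
    by apply: der_eq (HQ y) _; rewrite bump_eq0// ler_normr; apply/orP; left; lra.
  pose k x := Q (1 * x + (- a)) + (-1) * Q (1 * x + (- b)).
  pose k' x := bump e (x - a) - bump e (x - b).
  have kC : Coo k.
    move=> n; apply: CkD; first exact: Ck_affine.
    by apply: CkM; [exact: Ck_cst|exact: Ck_affine].
  have kd x : is_derive x 1 k (k' x).
    have d1 : is_derive x 1 (fun y => Q (1 * y + (- a))) (bump e (x - a) * 1).
      by apply: der_comp; [rewrite mul1r; exact: HQ|der; ring].
    have d2 : is_derive x 1 (fun y => Q (1 * y + (- b))) (bump e (x - b) * 1).
      by apply: der_comp; [rewrite mul1r; exact: HQ|der; ring].
    by rewrite /k /k'; der; ring.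
  pose a1 := Num.min a b - e; pose b1 := Num.max a b + e.
  have [a1a a1b] : a1 <= a - e /\ a1 <= b - e by rewrite /a1 !lerD2r !ge_min !lexx orbT.
  have [b1a b1b] : a + e <= b1 /\ b + e <= b1 by rewrite /b1 !lerD2r !le_max !lexx orbT.
  have la1 : l1 < a1 by rewrite ltrBrDr lt_min; apply/andP; split; lra.
  have b1r : b1 < r1 by rewrite -ltrBrDr gt_max; apply/andP; split; lra.
  clearbody a1 b1.
  have k0 x : ~~ (a1 < x < b1) -> k x = 0.
    rewrite negb_and -!leNgt => /orP[xa|xb]; rewrite /k !mul1r.
      by rewrite !(@Ql (x + _)); lra.
    by rewrite !(@Qr (x + _)); lra.
  have a1b1 : a1 < b1 by lra.
  have la1' : l < a1 by lra.
  have b1r' : b1 < r by lra.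
  have [F [HF FE]] := H k k' a1 b1 la1' a1b1 b1r' kC kd k0.
  (* Removing C k and mid k from the primitive gives G' = (s D - mid) k', which is nowhere positive,
     while G has equal values at both ends. So G is constant, and G' must vanish at a. *)
  pose G x := s * F x - s * (C x * k x) - mid * k x.
  have dG x : a1 <= x <= b1 -> is_derive x 1 G ((s * D x - mid) * k' x).
    move=> /andP[ax xb]; have dF : is_derive x 1 F (A x * k' x + B x * k x).
      by apply: HF; rewrite ax.
    have dC : is_derive x 1 C (B x) by apply: HC; lra.
    by have dk := kd x; rewrite /G; der; rewrite /D; ring.
  have G_le x : a1 <= x <= b1 -> (s * D x - mid) * k' x <= 0.
    move=> /andP[ax xb]; have B1 := bump_ge0 e (x - a).
    have B2 := bump_ge0 e (x - b); rewrite /k' mulrBr subr_le0.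
    apply: (@le_trans _ _ 0).
      have [xe|xe] := ltP `|x - a| e; last by rewrite (bump_eq0 xe) mulr0.
      rewrite mulr_le0_ge0// subr_le0.
      have : `|x - a| < e1 by lra.
      by move=> /He1; rewrite ltr_norml => /andP[]; lra.
    have [xe|xe] := ltP `|x - b| e; last by rewrite (bump_eq0 xe) mulr0.
    rewrite mulr_ge0// subr_ge0.
    have : `|x - b| < e2 by lra.
    by move=> /He2; rewrite ltr_norml => /andP[]; lra.
  have kab1 : k a1 = 0 by apply: k0; rewrite ltxx.
  have kbb1 : k b1 = 0 by apply: k0; rewrite ltxx andbF.
  have GE : G a1 = G b1 by rewrite /G kab1 kbb1 FE !mulr0.
  have Gcst x : a1 <= x <= b1 -> G x = G a1.
    move=> /andP[ax xb]; apply/eqP; rewrite eq_le; apply/andP; split.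
      apply: (der_le0_ge (df := fun x => (s * D x - mid) * k' x)) => // y /andP[ay yx];
      [apply: dG|apply: G_le]; by rewrite ay (le_trans yx).
    rewrite GE.
    apply: (der_le0_ge (df := fun x => (s * D x - mid) * k' x)) => // y /andP[ay yx];
      [apply: dG|apply: G_le]; by rewrite yx (le_trans ax).
  have dGa : is_derive a 1 G 0.
    apply: (is_derive_near (f := fun=> G a1)).
    exists e => //; move=> y /=; rewrite distrC => ya; apply/esym/Gcst.
    by move: ya; rewrite ltr_norml; lra.
  have := is_derive_unique dGa (dG a _).
  have aab : a1 <= a <= b1 by lra.
  move=> /(_ aab)/esym/eqP; rewrite mulf_eq0 => /orP[/eqP|].
    by rewrite /mid; lra.
  (* Otherwise b would lie in the neighbourhood of a where s D < mid. Hence the bump at b vanishes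
     at a and cannot cancel the one at a. *)
  have abe : e <= `|a - b|.
    rewrite leNgt; apply/negP => abe.
    have : `|b - a| < e1 by rewrite distrC; lra.
    by move=> /He1; rewrite /mid ltr_norml => /andP[]; lra.
  by rewrite /k' subrr (bump_eq0 abe) subr0 gt_eqF// bump_gt0.
have Dcst x : l1 < x < r1 -> D x = D x0.
  have x0lr : l1 < x0 < r1 by rewrite lx.
  move=> xlr; apply/eqP; case: (ltgtP (D x) (D x0)) => // Dx; exfalso.
    by apply: (key 1 x x0); rewrite ?expr1n// !mul1r.
  by apply: (key (-1) x x0); rewrite ?sqrrN ?expr1n// !mulN1r ltrN2.
apply: (is_derive_near (f := fun x => C x + D x0)).
  exists (Num.min (x0 - l1) (r1 - x0)); first by rewrite /= lt_min !subr_gt0 lx.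
  move=> y /=; rewrite lt_min !ltr_norml => /andP[/andP[_ y1] /andP[y2 _]].
  have ylr : l1 < y < r1.
    by move: y1 y2; rewrite opprB !ltrD2l !ltrN2 => -> ->.
  by rewrite -(Dcst y ylr) /D subrKC.
have dC : is_derive x0 1 C (B x0) by apply: HC; lra.
by der; ring.
Qed.

End DuBoisReymond.

(** * The Lebesgue measure on tuples *)

Section TupleMeasurability.
Context {R : realType}.
Local Notation mR := (measurableTypeR R).

Lemma measurable_forall_tnth n (A : 'I_n -> set mR) :
  (forall i, measurable (A i)) ->
  measurable [set t : n.-tuple mR | forall i, A i (tnth t i)].
Proof.
move=> mA.
rewrite (_ : [set _ | _] = \bigcap_(i in [set: 'I_n])
    ((@tnth n mR)^~ i @^-1` A i)); last first.
  by apply/seteqP; split => t /= H i; [move=> _|]; exact: H.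
apply: fin_bigcap_measurable => // i _.
by rewrite -[X in measurable X]setTI; exact: measurable_tnth.
Qed.

(** The sigma-algebra on tuples is the product one; an open set is a countable union of boxes with
    rational centres and radii 1/(k+1). *)
Lemma measurable_vec_of_tuple n (U : set 'rV[R]_n) : open U ->
  measurable (@vec_of_tuple R n @^-1` U : set (n.-tuple mR)).
Proof.
move=> oU.
pose box (z : n.-tuple rat * nat) : set 'rV[R]_n :=
  [set x | forall i, `|ratr (tnth z.1 i) - x ord0 i| < z.2.+1%:R^-1].
rewrite (_ : _ @^-1` U =
  \bigcup_(z in [set z | box z `<=` U]) (@vec_of_tuple R n @^-1` box z)); last first.
  apply/seteqP; split => [t /= Ut|t [z /= zU zt]]; last exact: zU.
  have /nbhs_ballP[e /= e0 eU] := open_nbhs_nbhs (conj oU Ut).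
  have [k ke] : exists k : nat, k.+1%:R^-1 < e / 2.
    have e20 : 0 < e / 2 by rewrite divr_gt0.
    near \oo => k; exists k; near: k; exact: near_infty_natSinv_lt (PosNum e20).
  have q_ex i : exists q : rat, `|ratr q - tnth t i| < k.+1%:R^-1.
    have : tnth t i - k.+1%:R^-1 < tnth t i + k.+1%:R^-1 by rewrite ltrD2l gtrN.
    move=> /rat_in_itvoo[q]; rewrite in_itv/= => /andP[q1 q2].
    by exists q; rewrite ltr_distlC ltrBlDr; move: q1 q2; rewrite ltrBlDr => -> ->.
  pose q i := projT1 (cid (q_ex i)).
  have qP i : `|ratr (q i) - tnth t i| < k.+1%:R^-1 by rewrite /q; case: cid.
  exists ([tuple q i | i < n], k) => /=.
    move=> y /= yb; apply: eU; split=> // i j; rewrite ord1 mxE /ball /=.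
    have := yb j; rewrite tnth_mktuple distrC => H1; have := qP j; rewrite distrC => H2.
    rewrite -(subrKA (ratr (q j))) (le_lt_trans (ler_normD _ _))//.
    rewrite (distrC _ (y ord0 j)) [ltRHS]splitr ltrD//; exact: lt_trans ke.
  by move=> i /=; rewrite tnth_mktuple mxE.
rewrite bigcup_mkcond; apply: countable_bigcupT_measurable => [|z].
  exact: countableP.
case: ifPn => // _.
rewrite (_ : _ @^-1` _ =
  [set t : n.-tuple mR | forall i, ball (ratr (tnth z.1 i) : R) z.2.+1%:R^-1 (tnth t i)]).
  apply: (measurable_forall_tnth (A := fun i => ball (ratr (tnth z.1 i) : R) _)) => i.
  by apply: open_measurable; exact: ball_open.
by apply/seteqP; split => t /= H i; have := H i; rewrite mxE.
Unshelve. all: by end_near. Qed.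

Lemma measurable_continuous_vec n (f : 'rV[R]_n -> R) : continuous f ->
  measurable_fun [set: n.-tuple mR] (f \o @vec_of_tuple R n).
Proof.
move=> /continuousP cf; apply: (measurability _ (RGenOpens.measurableE R)).
move=> _ [_ [a [b ->] <-]]; rewrite setTI comp_preimage.
by apply: measurable_vec_of_tuple; apply: cf; exact: itv_open.
Qed.

Definition normsq n (t : n.-tuple mR) : R := \sum_(i < n) tnth t i ^+ 2.

Lemma dotp_vec_of_tuple n (t : n.-tuple mR) :
  dotp (vec_of_tuple t) (vec_of_tuple t) = normsq t.
Proof. by apply: eq_bigr => i _; rewrite !mxE expr2. Qed.

Lemma normsq_ge0 n (t : n.-tuple mR) : 0 <= normsq t.
Proof. by apply: sumr_ge0 => i _; rewrite sqr_ge0. Qed.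

Lemma sqr_tnth_le n (t : n.-tuple mR) i : tnth t i ^+ 2 <= normsq t.
Proof.
rewrite /normsq (bigD1 i)//= lerDl sumr_ge0// => j _; exact: sqr_ge0.
Qed.

Lemma measurable_normsq n : measurable_fun [set: n.-tuple mR] (@normsq n).
Proof.
apply: measurable_sum => i; apply: measurable_funX; exact: measurable_tnth.
Qed.

Lemma measurable_normsq_preimage n (A : set R) : measurable (A : set mR) ->
  measurable [set t : n.-tuple mR | A (normsq t)].
Proof. by move=> mA; rewrite -[X in measurable X]setTI; exact: measurable_normsq. Qed.

Lemma uball_tupleE n : @uball_tuple R n = [set t | normsq t < 1].
Proof.
apply/seteqP; split => t; rewrite /uball_tuple /uball /= /enorm dotp_vec_of_tuple;
by rewrite -[X in Num.sqrt _ < X]sqrtr1 ltr_sqrt.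
Qed.

Lemma measurable_uball_tuple n : measurable (@uball_tuple R n).
Proof.
rewrite uball_tupleE; apply: (measurable_normsq_preimage (A := `]-oo, 1[%classic)).
exact: measurable_itv.
Qed.

Lemma ge0_integral_lebesgue_tupleS n (f : n.+1.-tuple mR -> \bar R) :
  measurable_fun setT f -> (forall t, 0 <= f t)%E ->
  (\int[lebesgue_tuple n.+1]_t f t =
   \int[@lebesgue_measure R]_x \int[lebesgue_tuple n]_t f (tcons (x, t)))%E.
Proof.
move=> mf f0; have mt := @measurable_tcons R n.
transitivity (\int[pushforward (@lebesgue_measure R \x lebesgue_tuple n)%E (@tcons R n)]_t f t)%E.
  by [].
rewrite ge0_integral_pushforward// preimage_setT.
by rewrite fubini_tonelli1//; [exact: (measurableT_comp mf mt)|move=> z; exact: f0].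
Qed.

Definition cube n (M : R) : set (n.-tuple mR) :=
  [set t | forall i, `|tnth t i| <= M].

Lemma measurable_cube n M : measurable (@cube n M).
Proof.
have -> : cube M = [set t : n.-tuple mR | forall i, `[-M, M]%classic (tnth t i)].
  by apply/seteqP; split => t /= H i; have := H i; rewrite in_itv/= ler_norml.
by apply: (measurable_forall_tnth (A := fun=> `[-M, M]%classic)) => i.
Qed.

Lemma lebesgue_cube n M : 0 < M -> lebesgue_tuple n (cube M) = ((2 * M) ^+ n)%:E.
Proof.
move=> M0; elim: n => [|n IHn].
  have c0 : @cube 0 M [tuple] by move=> [].
  by rewrite /= /dirac indicE mem_set// expr0.
transitivity ((@lebesgue_measure R \x lebesgue_tuple n)%E
   (`[-M, M]%classic `*` @cube n M)).
  rewrite /= /lebesgue_cons /pushforward; congr (_ _); apply/seteqP; split.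
  - move=> [x t] /= H; split; first by have := H ord0; rewrite tnth0 in_itv/= ler_norml.
    by move=> i; have := H (lift ord0 i); rewrite tnthS.
  - move=> [x t] /= [Hx Ht] i; have [j ->|->] := unliftP ord0 i.
      by rewrite tnthS.
    by rewrite tnth0; move: Hx; rewrite in_itv/= ler_norml.
rewrite product_measure1E//; last exact: measurable_cube.
have LM : lebesgue_measure (`[-M, M]%classic : set R) = (2 * M)%:E.
  rewrite lebesgue_measure_itv/= lte_fin gtrN// -EFinD opprK.
  by congr EFin; ring.
by rewrite IHn exprS EFinM -LM.
Qed.

Definition scale_tuple (r : R) n (t : n.-tuple mR) : n.-tuple mR :=
  [tuple of map (fun x => r * x) t].

Lemma measurable_scale_tuple r n : measurable_fun setT (@scale_tuple r n).
Proof.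
apply/measurable_fun_tnthP => i.
rewrite (_ : _ \o _ = fun t => r * tnth t i); last first.
  by apply/funext => t; rewrite /= tnth_map.
apply: measurable_funM => //; exact: measurable_tnth.
Qed.

(** By uniqueness of Lebesgue measure: r times its image under x -> r x gives intervals their
    length. *)
Lemma ge0_integral_scale1 (r : R) (f : mR -> \bar R) : 0 < r ->
  measurable_fun setT f -> (forall t, 0 <= f t)%E ->
  (\int[@lebesgue_measure R]_x f (r * x)%R =
   r^-1%:E * \int[@lebesgue_measure R]_x f x)%E.
Proof.
move=> r0 mf f0.
have r'0 : 0 <= r by exact: ltW.
have mr : measurable_fun setT (fun x : mR => (r * x : mR)) by exact: measurable_funM.
pose nu : {measure set mR -> \bar R} :=
  measure_function_pushforward__canonical__measure_function_Measure
    (@lebesgue_measure R) mr.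
have H (A : set mR) : measurable A -> lebesgue_measure A = mscale (NngNum r'0) nu A.
  move=> mA; apply: lebesgue_measure_unique => // _ [[a b] _ <-].
  have pre : (fun x : mR => (r * x : mR)) @^-1` `]a, b]%classic =
      `]a / r, b / r]%classic :> set R.
    by apply/seteqP; split => x /=; rewrite !in_itv/= ltr_pdivrMr// ler_pdivlMr// mulrC.
  transitivity (r%:E * lebesgue_measure (`](a / r)%R, (b / r)%R]%classic : set R))%E; last first.
    by rewrite -pre.
  rewrite !lebesgue_measure_itv/= !lte_fin ltr_pM2r ?invr_gt0//.
  case: ifPn => _; last by rewrite mule0.
  by rewrite -!EFinB -EFinM; congr EFin; field; rewrite gt_eqF.
rewrite [in RHS](eq_measure_integral (mscale (NngNum r'0) nu)); last by move=> A mA _; exact: H.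
have E2 : (\int[nu]_x f x = \int[@lebesgue_measure R]_x f (r * x)%R)%E.
  by rewrite (ge0_integral_pushforward mr _ measurableT mf)// => x _; exact: f0.
rewrite ge0_integral_mscale// muleA -EFinM /= mulVf ?gt_eqF// mul1e.
exact/esym/E2.
Qed.

Lemma ge0_integral_scale (r : R) n (f : n.-tuple mR -> \bar R) : 0 < r ->
  measurable_fun setT f -> (forall t, 0 <= f t)%E ->
  (\int[lebesgue_tuple n]_t f (scale_tuple r t) =
   (r^-1 ^+ n)%:E * \int[lebesgue_tuple n]_t f t)%E.
Proof.
move=> r0; elim: n f => [|n IHn] f mf f0.
  rewrite expr0 mul1e; apply: eq_integral => t _; congr (f _).
  by apply: eq_from_tnth => -[].
have mcons x : measurable_fun setT (fun t : n.-tuple mR => tcons (x : mR, t)).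
  by apply: measurable_cons => //; exact: measurable_id.
have rn0 : 0 <= r^-1 ^+ n by rewrite exprn_ge0// invr_ge0 ltW.
have mF : measurable_fun setT
    (fun x : mR => \int[lebesgue_tuple n]_t f (tcons (x, t)))%E.
  apply: (measurable_fun_fubini_tonelli_F (m2 := lebesgue_tuple n) (f \o @tcons R n)).
    by apply: (measurableT_comp mf); exact: measurable_tcons.
  by move=> z; exact: f0.
rewrite ge0_integral_lebesgue_tupleS//; last first.
  by apply: (measurableT_comp mf); exact: measurable_scale_tuple.
rewrite ge0_integral_lebesgue_tupleS//.
transitivity (\int[@lebesgue_measure R]_x ((r^-1 ^+ n)%:E *
   \int[lebesgue_tuple n]_t f (tcons ((r * x)%R : mR, t))))%E.
  apply: eq_integral => x _.
  rewrite -(IHn (fun t => f (tcons ((r * x)%R : mR, t))))//; last first.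
    exact: (measurableT_comp mf (mcons _)).
  by apply: eq_integral => t _; congr (f _); exact/val_inj.
have mFr : measurable_fun setT (fun x : mR =>
    \int[lebesgue_tuple n]_t f (tcons ((r * x)%R : mR, t)))%E.
  by apply: (measurableT_comp mF); exact: measurable_funM.
have Fr0 (x : mR) : setT x ->
    (0 <= \int[lebesgue_tuple n]_t f (tcons ((r * x)%R : mR, t)))%E.
  by move=> _; apply: integral_ge0 => t _; exact: f0.
have rn0E : (0 <= (r^-1 ^+ n)%:E)%E by rewrite lee_fin.
rewrite (ge0_integralZl _ measurableT mFr Fr0 rn0E).
rewrite (ge0_integral_scale1 (f := fun x : mR =>
   (\int[lebesgue_tuple n]_t f (tcons (x, t)))%E))//.
  by rewrite muleA -EFinM exprSr.
by move=> x; exact: integral_ge0.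
Qed.

End TupleMeasurability.

(** * Volumes of Euclidean balls *)

Section BallVolume.
Context {R : realType}.
Local Notation mR := (measurableTypeR R).

(** Balls are indexed by the squared radius, the variable in which radial functions are written. *)
Definition ballsq n (s : R) : set (n.-tuple mR) := [set t | normsq t <= s].

Lemma measurable_ballsq n s : measurable (@ballsq n s).
Proof.
apply: (measurable_normsq_preimage (A := `]-oo, s]%classic)); exact: measurable_itv.
Qed.

Lemma ballsq_sub_cube n s M : 0 <= M -> s <= M ^+ 2 -> @ballsq n s `<=` cube M.
Proof.
move=> M0 sM t /= ts i; rewrite -ler_sqr ?nnegrE// real_normK ?num_real//.
by apply: le_trans (sqr_tnth_le t i) _; exact: le_trans ts _.
Qed.

Lemma lebesgue_sub_cube_lty n (D : set (n.-tuple mR)) M : 0 < M -> measurable D ->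
  D `<=` cube M -> (lebesgue_tuple n D < +oo)%E.
Proof.
move=> M0 mD DM; apply: (@le_lt_trans _ _ (lebesgue_tuple n (cube M))).
  by apply: le_measure => //; rewrite inE//; exact: measurable_cube.
by rewrite lebesgue_cube// ltry.
Qed.

Lemma ballsq_lty n s : (lebesgue_tuple n (ballsq s) < +oo)%E.
Proof.
have M0 : 0 < `|s| + 1 by rewrite ltr_wpDl.
apply: (lebesgue_sub_cube_lty M0 (@measurable_ballsq n s)).
apply: ballsq_sub_cube; first exact: ltW.
have := ler_norm s; have := normr_ge0 s; rewrite expr2; nra.
Qed.

Definition vol n (s : R) : R := fine (lebesgue_tuple n (ballsq s)).

Lemma volK n s : (vol n s)%:E = lebesgue_tuple n (ballsq s).
Proof. by rewrite /vol fineK// ge0_fin_numE// ballsq_lty. Qed.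

Lemma normsq_scale n r (t : n.-tuple mR) :
  normsq (scale_tuple r t) = r ^+ 2 * normsq t.
Proof.
rewrite /normsq mulr_sumr; apply: eq_bigr => i _.
by rewrite /scale_tuple tnth_map exprMn.
Qed.

Lemma vol_scale n s : 0 < s -> vol n s = vol n 1 * Num.sqrt s ^+ n.
Proof.
move=> s0; have q0 : 0 < Num.sqrt s by rewrite sqrtr_gt0.
have r0 : 0 < (Num.sqrt s)^-1 by rewrite invr_gt0.
have := @ge0_integral_scale R (Num.sqrt s)^-1 n (fun t => (\1_(@ballsq n 1) t)%:E) r0.
rewrite invrK => H.
apply: EFin_inj; rewrite EFinM !volK muleC.
rewrite -(setIT (ballsq 1)) -(setIT (ballsq s)).
rewrite -!integral_indic//; [|exact: measurable_ballsq|exact: measurable_ballsq].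
rewrite -H.
- apply: eq_integral => t _; congr EFin; rewrite !indicE; congr (_ %:R).
  by congr nat_of_bool; apply/idP/idP; rewrite !inE /ballsq /= normsq_scale
    exprVn sqr_sqrtr ?(ltW s0)// ler_pdivrMl// mulr1.
- by apply/measurable_EFinP; apply: measurable_indic; exact: measurable_ballsq.
- by move=> t; rewrite lee_fin.
Qed.

(** The cube of half-side 1/n lies in the unit ball: n squares, each at most (1/n)^2 <= 1/n, add up
    to at most 1. *)
Lemma vol1_gt0 n : (0 < n)%N -> 0 < vol n 1.
Proof.
move=> n0; have n0' : 0 < n%:R :> R by rewrite ltr0n.
have M0 : 0 < n%:R^-1 :> R by rewrite invr_gt0.
rewrite -lte_fin volK; apply: (@lt_le_trans _ _ (lebesgue_tuple n (cube n%:R^-1))).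
  by rewrite lebesgue_cube// lte_fin exprn_gt0// mulr_gt0.
apply: le_measure; rewrite ?inE; [exact: measurable_cube|exact: measurable_ballsq|].
move=> t /= H; rewrite /ballsq /= /normsq.
apply: (@le_trans _ _ (\sum_(i < n) n%:R^-1)).
  apply: ler_sum => i _; have Hi := H i.
  rewrite -real_normK ?num_real// expr2.
  apply: (@le_trans _ _ (n%:R^-1 * 1)); last by rewrite mulr1.
  apply: ler_pM => //; apply: le_trans Hi _.
  by rewrite invf_le1// ler1n.
by rewrite sumr_const card_ord -[leLHS]mulr_natl mulfV// gt_eqF.
Qed.

Lemma integrable_bounded n (D : set (n.-tuple mR)) (f : n.-tuple mR -> R) M C :
  0 < M -> measurable D -> D `<=` cube M -> measurable_fun D f ->
  (forall t, D t -> `|f t| <= C) -> (lebesgue_tuple n).-integrable D (EFin \o f).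
Proof.
move=> M0 mD DM mf fC; apply: measurable_bounded_integrable => //.
  exact: lebesgue_sub_cube_lty DM.
exists C; split; first exact: num_real.
by move=> y Cy t Dt; apply: le_trans (fC _ Dt) _; exact: ltW.
Qed.

End BallVolume.

(** * Integration of a partial derivative *)

Section IntegrationByParts.
Context {R : realType}.
Local Notation mR := (measurableTypeR R).

Lemma integral_derive_compact (g g' : R -> R) (M : R) : 0 < M ->
  (forall s : R, is_derive s 1 g (g' s)) -> continuous g' ->
  (forall s, M < `|s| -> g' s = 0) -> g M = g (- M) ->
  (\int[@lebesgue_measure R]_s (g' s)%:E = 0)%E.
Proof.
move=> M0 dg cg g0 gM.
transitivity (\int[@lebesgue_measure R]_(s in `[(- M)%R, M]) (g' s)%:E)%E.
  rewrite [RHS]integral_mkcond; apply: eq_integral => s _.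
  rewrite patchE mem_setE in_itv/= -ler_norml; case: ifPn => //.
  by rewrite -ltNge => /g0 ->.
have cvg x : g y @[y --> x] --> g x by exact: is_derive_cvg (dg x).
rewrite (@continuous_FTC2 _ _ g).
- by rewrite gM -EFinB subrr.
- by rewrite gtrN.
- exact: continuous_subspaceT.
- split; first by move=> x _; case: (dg x).
  + by apply: cvg_at_right_filter; exact: cvg.
  + by apply: cvg_at_left_filter; exact: cvg.
- by move=> x _; rewrite derive1E; case: (dg x).
Qed.

Definition upd n (t : n.-tuple mR) (i : 'I_n) (s : mR) : n.-tuple mR :=
  [tuple if j == i then s else tnth t j | j < n].

Lemma upd_tcons0 n (x s : mR) (t : n.-tuple mR) :
  upd (tcons (x, t)) ord0 s = tcons (s, t).
Proof.
apply: eq_from_tnth => j; rewrite tnth_mktuple.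
have [k ->|->] := unliftP ord0 j; last by rewrite eqxx /tcons tnth0.
by rewrite /tcons !tnthS.
Qed.

Lemma upd_tcons_lift n (x s : mR) (t : n.-tuple mR) i :
  upd (tcons (x, t)) (lift ord0 i) s = tcons (x, upd t i s).
Proof.
apply: eq_from_tnth => j; rewrite tnth_mktuple.
have [k ->|->] := unliftP ord0 j; last by rewrite /tcons !tnth0.
by rewrite (inj_eq lift_inj) /tcons !tnthS tnth_mktuple.
Qed.

Lemma cube_tcons n M (x : mR) (t : n.-tuple mR) :
  cube M (tcons (x, t)) <-> `|x| <= M /\ cube M t.
Proof.
split=> [H|[Hx Ht] i].
  split; first by have := H ord0; rewrite tnth0.
  by move=> i; have := H (lift ord0 i); rewrite tnthS.
have [k ->|->] := unliftP ord0 i; last by rewrite tnth0.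
by rewrite tnthS; exact: Ht.
Qed.

(** Fubini makes the i-th variable innermost, where the fundamental theorem of calculus applies: for
    i = 0 the order of integration is exchanged, otherwise the induction hypothesis handles the
    remaining coordinates. The bound C and the support in a cube provide integrability. *)
Lemma integral_partial n (i : 'I_n) (f df : n.-tuple mR -> R) (M C : R) : 0 < M ->
  measurable_fun setT df ->
  (forall t, `|df t| <= C) -> (forall t, ~ cube M t -> df t = 0) ->
  (forall t (s : R), is_derive s 1 (fun s => f (upd t i s)) (df (upd t i s))) ->
  (forall t, continuous (fun s : R => df (upd t i s))) ->
  (forall t s, M <= `|s| -> f (upd t i s) = 0) ->
  (\int[lebesgue_tuple n]_t (df t)%:E = 0)%E.
Proof.
move=> M0; elim: n i f df => [[]//|n IHn] i f df mdf dfC df0 dfE cdf f0.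
have mt := @measurable_tcons R n.
have C0 : 0 <= C by apply: le_trans (normr_ge0 _) (dfC (nseq_tuple n.+1 (0 : R))).
have idf : (lebesgue_tuple n.+1).-integrable setT (EFin \o df).
  have : (lebesgue_tuple n.+1).-integrable (cube M) (EFin \o df).
    apply: (@integrable_bounded R n.+1 _ _ M C) => //; first exact: measurable_cube.
    exact: measurable_funTS.
  rewrite integrable_mkcond//; last exact: measurable_cube.
  apply: eq_integrable => // t _; rewrite patchE; case: ifPn => //.
  by rewrite notin_setE => /df0 /= ->.
have mdt : measurable_fun setT ((EFin \o df) \o @tcons R n).
  by apply: measurableT_comp => //; exact/measurable_EFinP.
have idt : (@lebesgue_measure R \x lebesgue_tuple n)%E.-integrable setT
    ((EFin \o df) \o @tcons R n).
  apply/integrableP; split => //.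
  have /integrableP[_] := idf.
  rewrite (_ : (\int[lebesgue_tuple n.+1]_x `|(EFin \o df) x| =
    \int[pushforward (@lebesgue_measure R \x lebesgue_tuple n)%E (@tcons R n)]_x
      `|(EFin \o df) x|)%E)//.
  rewrite ge0_integral_pushforward//.
  by apply: measurableT_comp => //; exact/measurable_EFinP.
transitivity (\int[(@lebesgue_measure R \x lebesgue_tuple n)%E]_z
    ((EFin \o df) \o @tcons R n) z)%E.
  transitivity (\int[pushforward (@lebesgue_measure R \x lebesgue_tuple n)%E (@tcons R n)]_t
    ((EFin \o df) t))%E; first by [].
  by rewrite integral_pushforward//; exact/measurable_EFinP.
have [j iE|iE] := unliftP ord0 i; subst i.
  rewrite -integral12_prod_meas1// integral0_eq// => x _.
  apply: (IHn j (fun t => f (tcons (x, t))) (fun t => df (tcons (x, t)))).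
  - have := measurable_cons (@measurable_cst _ _ _ _ setT (x : mR)) (@measurable_id _ (n.-tuple mR) setT).
    exact: measurableT_comp mdf.
  - by move=> t; exact: dfC.
  - by move=> t tM; apply: df0 => /cube_tcons[].
  - by move=> t s; have := dfE (tcons (x, t)) s; rewrite upd_tcons_lift;
       under eq_fun do rewrite upd_tcons_lift.
  - by move=> t; have := cdf (tcons (x, t)); under eq_fun do rewrite upd_tcons_lift.
  - by move=> t s sM; rewrite -upd_tcons_lift f0.
rewrite -integral21_prod_meas1// integral0_eq// => t _.
apply: (@integral_derive_compact (fun s => f (tcons (s, t))) (fun s => df (tcons (s, t))) M) => //.
- by move=> s; have := dfE (tcons (s, t)) s; rewrite upd_tcons0;
       under eq_fun do rewrite upd_tcons0.
- by have := cdf (tcons (0 : mR, t)); under eq_fun do rewrite upd_tcons0.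
- by move=> s sM; apply: df0 => /cube_tcons[]; rewrite leNgt sM.
- rewrite -(upd_tcons0 (0 : mR) M) -(upd_tcons0 (0 : mR) (- M)).
  by rewrite !f0// ?normrN ger0_norm// ltW.
Qed.

End IntegrationByParts.

(** * Integrals of radial functions *)

Section RadialIntegral.
Context {R : realType}.
Local Notation mR := (measurableTypeR R).

Lemma is_derive_expansion (f : R -> R) (x l : R) : is_derive x 1 f l ->
  forall e, 0 < e -> exists2 d : R, 0 < d & forall h, h != 0 -> `|h| < d ->
    `|f (x + h) - f x - l * h| <= e * `|h|.
Proof.
move=> [df dfl] e e0.
have : (h^-1 *: (f (h *: 1 + x) - f x)) @[h --> 0^'] --> l.
  by rewrite -dfl; exact: df.
move=> /cvgrPdist_lt /(_ _ e0).
rewrite near_withinE => -[d /= d0 H].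
exists d => // h hN hd; have := H h.
rewrite /= sub0r normrN => /(_ hd hN) /ltW.
have -> : h^-1 *: (f (h *: 1 + x) - f x) = h^-1 * (f (x + h) - f x).
  by rewrite [h *: 1]mulr1 (addrC h).
rewrite -(ler_pM2r (x := `|h|)) ?normr_gt0// -normrM distrC mulrBl.
by rewrite mulrAC mulVf// mul1r distrC -normrN opprB distrC.
Qed.

(** Differentiation with respect to V followed by the chain rule. V will be the volume of a ball,
    with which integrals over shells compare directly. *)
Lemma is_derive_relative (F V : R -> R) (x l V' : R) : is_derive x 1 V V' ->
  (forall e, 0 < e -> exists2 d : R, 0 < d & forall h, h != 0 -> `|h| < d ->
    `|F (x + h) - F x - l * (V (x + h) - V x)| <= e * `|V (x + h) - V x|) ->
  is_derive x 1 F (l * V').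
Proof.
move=> dV H; apply: is_derive_eps => e e0.
pose A := `|V'| + 1; have A0 : 0 < A by rewrite ltr_wpDl.
pose B := `|l| + 1; have B0 : 0 < B by rewrite ltr_wpDl.
have [d1 d10 H1] := is_derive_expansion dV ltr01.
have [|d2 d20 H2] := is_derive_expansion dV (e := e / (2 * B)).
  by rewrite divr_gt0// mulr_gt0.
have [|d3 d30 H3] := H (e / (2 * A)); first by rewrite divr_gt0// mulr_gt0.
exists (Num.min d1 (Num.min d2 d3)); first by rewrite !lt_min d10 d20.
move=> h hN; rewrite !lt_min => /andP[h1 /andP[h2 h3]].
have {}H1 := H1 _ hN h1; have {}H2 := H2 _ hN h2; have {}H3 := H3 _ hN h3.
set DV := V (x + h) - V x in H1 H2 H3 *; set DF := F (x + h) - F x in H3 *.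
have hp : 0 < `|h| by rewrite normr_gt0.
have DVA : `|DV| <= A * `|h|.
  rewrite -(subrK (V' * h) DV) (le_trans (ler_normD _ _))// normrM /A mulrDl.
  by rewrite addrC lerD2l.
have -> : DF - l * V' * h = (DF - l * DV) + l * (DV - V' * h) by ring.
rewrite (le_trans (ler_normD _ _))// normrM.
have -> : e * `|h| = e / (2 * A) * (A * `|h|) + B * (e / (2 * B) * `|h|).
  by field; rewrite !gt_eqF.
apply: lerD.
  by apply: le_trans H3 _; rewrite ler_wpM2l// divr_ge0 ?(ltW e0)// mulr_ge0 ?(ltW A0).
by apply: ler_pM => //; rewrite /B lerDl.
Qed.

Lemma bounded_segment (g : R -> R) (a b : R) : a <= b ->
  (forall y, a <= y <= b -> {for y, continuous g}) ->
  exists2 C : R, 0 <= C & forall y, a <= y <= b -> `|g y| <= C.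
Proof.
move=> ab cg.
have [|c cab H] := @EVT_max R (fun y => `|g y|) a b ab.
  apply: continuous_in_subspaceT => y; rewrite inE/= in_itv/= => yab.
  by apply: continuous_comp; [exact: cg|exact: norm_continuous].
by exists `|g c| => // y yab; apply: H; rewrite in_itv.
Qed.

Implicit Types (s a b m C y : R).
Variable n : nat.
Hypothesis n_gt0 : (0 < n)%N.
Local Notation lam := (@lebesgue_tuple R n).
Local Notation V := (@vol R n).

Lemma vol_derive s : 0 < s ->
  is_derive s 1 V (V 1 * (n%:R / (2 * s) * Num.sqrt s ^+ n)).
Proof.
move=> s0.
apply: (is_derive_near (f := fun y => V 1 * Num.sqrt y ^+ n)).
  exists s => // y /=; rewrite /ball/= ltr_norml => /andP[_ ys].
  by rewrite [RHS]vol_scale//; move: ys; rewrite ltrBlDr ltrDl.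
have q0 : 0 < Num.sqrt s by rewrite sqrtr_gt0.
have dsq := is_derive1_sqrt s0.
der; rewrite mulr0 addr0; congr (_ * _).
have sE : s = Num.sqrt s ^+ 2 by rewrite sqr_sqrtr// ltW.
move: (Num.sqrt s) sE q0 => q -> q0.
case: n n_gt0 => // m _ /=; rewrite [q ^+ m.+1]exprS; field.
by rewrite gt_eqF.
Qed.

Variable g : R -> R.
Hypothesis cg : forall s, s < 1 -> {for s, continuous g}.

Lemma measurable_radial (D : set (n.-tuple mR)) : D `<=` @uball_tuple R n ->
  measurable_fun D (fun t => g (normsq t)).
Proof.
move=> DU; apply: (@measurable_comp _ _ _ _ _ _ (`]-oo, 1[%classic : set mR)).
- exact: measurable_itv.
- by move=> _ [t Dt <-]; have := DU _ Dt; rewrite uball_tupleE /= in_itv.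
- apply: open_continuous_measurable_fun; first exact: interval_open.
  by move=> s; rewrite inE/= in_itv/=; exact: cg.
- exact: measurable_funTS (@measurable_normsq R n).
Qed.

Lemma ballsq_sub_uball s : s < 1 -> @ballsq R n s `<=` @uball_tuple R n.
Proof. by move=> s1 t; rewrite uball_tupleE /ballsq /= => ts; exact: le_lt_trans ts s1. Qed.

Lemma uball_tuple_sub_cube : @uball_tuple R n `<=` cube 1.
Proof.
rewrite uball_tupleE => t /= /ltW t1.
by apply: (@ballsq_sub_cube R n 1) => //; rewrite expr1n.
Qed.

Lemma integrable_radial s : 0 <= s < 1 ->
  lam.-integrable (ballsq s) (EFin \o (fun t => g (normsq t))).
Proof.
move=> /andP[s0 s1].
have [y /andP[_ ys]|C C0 HC] := @bounded_segment g 0 s s0.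
  by apply: cg; exact: le_lt_trans s1.
apply: (@integrable_bounded R n _ _ 1 C) => //.
- exact: measurable_ballsq.
- by move=> t /(ballsq_sub_uball s1); exact: uball_tuple_sub_cube.
- by apply: measurable_radial; exact: ballsq_sub_uball.
- by move=> t ts; apply: HC; rewrite normsq_ge0.
Qed.

Definition radint s : R := (\int[lam]_(t in ballsq s) g (normsq t))%R.

(** The difference is the integral over the shell a < |x|^2 <= b, whose measure is V b - V a. *)
Lemma radint_bounds a b m (M : R) : 0 <= a -> a <= b -> b < 1 ->
  (forall y, a <= y <= b -> m <= g y <= M) ->
  m * (V b - V a) <= radint b - radint a <= M * (V b - V a).
Proof.
move=> a0 ab b1 H.
pose S : set (n.-tuple mR) := [set t | `]a, b]%classic (normsq t)].
have mS : measurable S by apply: measurable_normsq_preimage; exact: measurable_itv.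
have mB x : measurable (@ballsq R n x) by exact: measurable_ballsq.
have BE : ballsq b = ballsq a `|` S.
  apply/seteqP; split => t; rewrite /ballsq /S /= in_itv/=.
    by move=> tb; have [ta|ta] := leP (normsq t) a; [left|right].
  by move=> [ta|/andP[]//]; exact: le_trans ab.
have disj : [disjoint ballsq a & S].
  apply/disj_setPS => t; rewrite /ballsq /S /= in_itv/= => -[ta /andP[]].
  by rewrite ltNge ta.
have b01 : 0 <= b < 1 by rewrite (le_trans a0).
have ib := integrable_radial b01.
have iS : lam.-integrable S (EFin \o (fun t => g (normsq t))).
  by apply: integrableS ib => //; rewrite BE; exact: subsetUr.
have i1 c : lam.-integrable (ballsq b) (EFin \o (fun=> c : R)).
  apply: (@integrable_bounded R n _ _ 1 `|c|) => //.
  by move=> t /(ballsq_sub_uball b1); exact: uball_tuple_sub_cube.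
have iS1 c : lam.-integrable S (EFin \o (fun=> c : R)).
  by apply: integrableS (i1 c) => //; rewrite BE; exact: subsetUr.
have gE : radint b - radint a = (\int[lam]_(t in S) g (normsq t))%R.
  rewrite /radint BE Rintegral_setU//; first by rewrite addrAC subrr add0r.
  by rewrite -BE.
have VE : V b - V a = fine (lam S).
  have : (\int[lam]_(t in ballsq b) (1 : R))%R =
      (\int[lam]_(t in ballsq a) (1 : R))%R + (\int[lam]_(t in S) (1 : R))%R.
    by rewrite BE Rintegral_setU// -BE.
  by rewrite !Rintegral_cst// !mul1r -!/(vol n _) => ->; rewrite addrAC subrr add0r.
rewrite gE VE -!Rintegral_cst//; apply/andP; split; apply: le_Rintegral => // t;
by rewrite /S /= in_itv/= => /andP[/ltW ta tb]; have /H/andP[] : a <= normsq t <= b by rewrite ta.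
Qed.

(** This stands in for polar coordinates: on a thin shell g is within e of g s, so the increment is
    g s times that of the volume, up to the factor e. *)
Lemma radint_derive s : 0 < s < 1 ->
  is_derive s 1 radint (g s * (V 1 * (n%:R / (2 * s) * Num.sqrt s ^+ n))).
Proof.
move=> /andP[s0 s1]; apply: is_derive_relative (vol_derive s0) _ => e e0.
have [d d0 Hd] := continuous_eps (cg s1) e0.
have rel a b : 0 <= a -> a <= b -> b < 1 ->
    (forall y, a <= y <= b -> `|y - s| < d) ->
    `|radint b - radint a - g s * (V b - V a)| <= e * `|V b - V a|.
  move=> a0 ab b1 H.
  have := @radint_bounds a b (g s - e) (g s + e) a0 ab b1.
  have Vab : V a <= V b.
    rewrite -lee_fin !volK; apply: le_measure; rewrite ?inE; try exact: measurable_ballsq.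
    by move=> t; rewrite /ballsq /= => /le_trans; exact.
  rewrite [`|V b - V a|]ger0_norm ?subr_ge0// ler_norml => /(_ _)/andP[|B1 B2].
    by move=> y /H/Hd; rewrite ltr_norml => /andP[? ?]; apply/andP; split; lra.
  by rewrite mulrBl in B1; rewrite mulrDl in B2; apply/andP; split; lra.
exists (Num.min d (Num.min s (1 - s))); first by rewrite !lt_min d0 s0 subr_gt0.
move=> h hN; rewrite !lt_min => /andP[hd /andP[hs h1]].
move: hd hs h1; rewrite !ltr_norml => /andP[? ?] /andP[? ?] /andP[? ?].
have [h0|h0] := ltP 0 h.
  by apply: rel; [lra|lra|lra|move=> y /andP[? ?]; rewrite ltr_norml; apply/andP; split; lra].
have := @rel (s + h) s; rewrite (distrC (V s)).
have -> : radint s - radint (s + h) - g s * (V s - V (s + h)) =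
  - (radint (s + h) - radint s - g s * (V (s + h) - V s)) by ring.
rewrite normrN; apply; [lra|lra|lra|].
by move=> y /andP[? ?]; rewrite ltr_norml; apply/andP; split; lra.
Qed.

Lemma radint_norm_le s C : 0 <= s < 1 -> (forall y, 0 <= y <= s -> `|g y| <= C) ->
  `|radint s| <= C * V s.
Proof.
move=> s01 HC; have is_ := integrable_radial s01.
have mB : measurable (@ballsq R n s) by exact: measurable_ballsq.
apply: le_trans (le_normr_Rintegral mB is_) _.
rewrite -Rintegral_cst//; apply: le_Rintegral => //.
- have := integrable_abse is_; apply: eq_integrable => //.
- apply: (@integrable_bounded R n _ _ 1 `|C|) => //.
  by move=> t /(ballsq_sub_uball (proj2 (andP s01))); exact: uball_tuple_sub_cube.
- by move=> t ts; apply: HC; rewrite normsq_ge0.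
Qed.

Lemma integral_uball_radial b : 0 <= b < 1 -> (forall y, b < y < 1 -> g y = 0) ->
  (\int[lam]_(t in @uball_tuple R n) (g (normsq t))%:E = (radint b)%:E)%E.
Proof.
move=> b01 g0; have b1 := proj2 (andP b01).
rewrite /radint /Rintegral fineK; last first.
  apply: integrable_fin_num; [exact: measurable_ballsq|exact: integrable_radial].
rewrite [LHS]integral_mkcond [RHS]integral_mkcond; apply: eq_integral => t _.
rewrite !patchE; case: ifPn => [tu|]; last first.
  rewrite notin_setE => tu; rewrite ifF//; apply/negbTE; rewrite notin_setE.
  by move=> /(ballsq_sub_uball b1).
case: ifPn => //; rewrite notin_setE /ballsq /= => /negP; rewrite -ltNge => bt.
by rewrite g0// bt /=; move: tu; rewrite inE uball_tupleE.
Qed.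

Lemma radint_le_uball s : 0 <= s < 1 -> (forall y, 0 <= y < 1 -> 0 <= g y) ->
  ((radint s)%:E <= \int[lam]_(t in @uball_tuple R n) (g (normsq t))%:E)%E.
Proof.
move=> s01 g0; have s1 := proj2 (andP s01).
rewrite /radint /Rintegral fineK; last first.
  apply: integrable_fin_num; [exact: measurable_ballsq|exact: integrable_radial].
apply: ge0_subset_integral => //.
- exact: measurable_ballsq.
- exact: measurable_uball_tuple.
- by apply/measurable_EFinP; exact: measurable_radial.
- by move=> t; rewrite uball_tupleE /= lee_fin => t1; rewrite g0// normsq_ge0.
- exact: ballsq_sub_uball.
Qed.

End RadialIntegral.

(** * Radial test functions and the divergence formula *)

Section Directional.
Context {R : realType} {n : nat}.
Implicit Types (f g : 'rV[R]_n -> R) (x v : 'rV[R]_n) (l : R).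

Let growth_line f x v (s : R) :
  (fun h : R => h^-1 *: ((fun h : R => f (h *: v + x)) (h *: 1 + s)
     - (fun h : R => f (h *: v + x)) s)) =
  (fun h : R => h^-1 *: (f (h *: v + (s *: v + x)) - f (s *: v + x))).
Proof.
by apply/funext => h; rewrite [h *: 1]mulr1 scalerDl addrA.
Qed.

Lemma is_derive_line f x v s l : is_derive (s *: v + x) v f l ->
  is_derive s 1 (fun h : R => f (h *: v + x)) l.
Proof.
by move=> [df <-]; split; rewrite ?/derivable ?/derive growth_line.
Qed.

Lemma line_is_derive f x v l : is_derive (0 : R) 1 (fun h : R => f (h *: v + x)) l ->
  is_derive x v f l.
Proof.
move=> [df <-]; apply: DeriveDef.
  by move: df; rewrite /derivable growth_line scale0r add0r.
by rewrite /derive growth_line scale0r add0r.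
Qed.

Definition evec (i : 'I_n) : 'rV[R]_n := delta_mx ord0 i.

Lemma is_derive_coord x i j :
  is_derive x (evec i) (fun y : 'rV[R]_n => y ord0 j) (j == i)%:R.
Proof.
apply: line_is_derive.
have -> : (fun h : R => (h *: evec i + x) ord0 j) =
    (fun h : R => h * (j == i)%:R + x ord0 j).
  by apply/funext => h; rewrite !mxE eqxx.
by der; ring.
Qed.

Lemma is_derive_dotp x i :
  is_derive x (evec i) (fun y : 'rV[R]_n => dotp y y) (2 * x ord0 i).
Proof.
have -> : (fun y : 'rV[R]_n => dotp y y) =
    \sum_(j < n) (fun y : 'rV[R]_n => y ord0 j * y ord0 j).
  by apply/funext => y; rewrite fct_sumE.
have -> : 2 * x ord0 i = \sum_(j < n) (x ord0 j * (j == i)%:R + x ord0 j * (j == i)%:R).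
  rewrite (bigD1 i)//= big1 ?addr0 ?eqxx; first by rewrite mulr1; ring.
  by move=> j /negbTE ->; rewrite mulr0 addr0.
apply: is_derive_sum => j.
exact: (is_deriveM (is_derive_coord x i j) (is_derive_coord x i j)).
Qed.

Lemma is_derive_radial (g g' : R -> R) x i : (forall s : R, is_derive s 1 g (g' s)) ->
  is_derive x (evec i) (fun y : 'rV[R]_n => g (dotp y y))
    (g' (dotp x x) * (2 * x ord0 i)).
Proof.
move=> dg; apply: line_is_derive.
apply: (@der_comp R g (fun h : R => dotp (h *: evec i + x) (h *: evec i + x))).
  by rewrite scale0r add0r; exact: dg.
apply: (is_derive_line (f := fun y : 'rV[R]_n => dotp y y)).
by rewrite scale0r add0r; exact: is_derive_dotp.
Qed.

Lemma dotp_continuous : continuous (fun y : 'rV[R]_n => dotp y y).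
Proof.
move=> x; rewrite /dotp.
have -> : (fun y : 'rV[R]_n => \sum_(i < n) y ord0 i * y ord0 i) =
    \sum_(j < n) (fun y : 'rV[R]_n => y ord0 j * y ord0 j).
  by apply/funext => y; rewrite fct_sumE.
elim/big_ind : _ => [|f g cf cg|j _].
- exact: cst_continuous.
- exact: continuousD.
- by apply: continuousM; exact: coord_continuous.
Qed.

Lemma sqr_coord_le_dotp x i : x ord0 i ^+ 2 <= dotp x x.
Proof.
by rewrite /dotp (bigD1 i)//= -expr2 lerDl sumr_ge0// => j _; rewrite -expr2 sqr_ge0.
Qed.

Lemma dotp_ge0 x : 0 <= dotp x x.
Proof. by apply: sumr_ge0 => i _; rewrite -expr2 sqr_ge0. Qed.

Lemma uballE x : uball x <-> dotp x x < 1.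
Proof. by rewrite /uball /= /enorm -[X in Num.sqrt _ < X]sqrtr1 ltr_sqrt. Qed.

Lemma compact_ballsq (b : R) : compact [set x : 'rV[R]_n | dotp x x <= b].
Proof.
apply: bounded_closed_compact.
  exists (`|b| + 1); split; first exact: num_real.
  move=> M bM x /= xb; rewrite [leLHS]/Num.norm/= mx_normrE.
  have M0 : 0 < M by apply: lt_trans bM; rewrite ltr_wpDl.
  apply/bigmax_leP; split; first exact: ltW.
  move=> [i j] _ /=; rewrite ord1 -ler_sqr ?nnegrE ?(ltW M0)// real_normK ?num_real//.
  apply: le_trans (sqr_coord_le_dotp x j) _; apply: le_trans xb _.
  by have := ler_norm b; have := normr_ge0 b; rewrite expr2; nra.
rewrite (_ : [set x | _] = (fun y : 'rV[R]_n => dotp y y) @^-1` [set s | s <= b])//.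
apply: closed_comp; last exact: closed_le.
by move=> x _; exact: dotp_continuous.
Qed.

Lemma bounded_on_ball f : continuous f ->
  exists2 C : R, 0 <= C & forall x, dotp x x <= 1 -> `|f x| <= C.
Proof.
move=> cf.
have [|||c _ H] := @EVT_max_rV R n (fun x => `|f x|) [set x : 'rV[R]_n | dotp x x <= 1].
- by exists 0; rewrite /= /dotp big1// => i _; rewrite mxE mul0r.
- exact: compact_ballsq.
- apply: continuous_subspaceT => x; apply: continuous_comp; first exact: cf.
  exact: norm_continuous.
by exists `|f c| => // x x1; apply: H; rewrite inE.
Qed.

(** Composing a radial function with a partial derivative leaves the radial class, since a factor
    x_i appears. Adding the coordinates, sums and products gives a class stable under all partial
    derivatives, as the iterated definition of [smooth] demands. *)
Inductive Rad : ('rV[R]_n -> R) -> Prop :=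
| Rad_coord i : Rad (fun x => x ord0 i)
| Rad_radial (g : R -> R) : Coo g -> Rad (fun x => g (dotp x x))
| Rad_add f g : Rad f -> Rad g -> Rad (fun x => f x + g x)
| Rad_mul f g : Rad f -> Rad g -> Rad (fun x => f x * g x).

Lemma Rad_cst (c : R) : Rad (fun=> c).
Proof. by apply: (@Rad_radial (fun=> c)) => m; exact: Ck_cst. Qed.

Lemma Rad_continuous f : Rad f -> continuous f.
Proof.
elim=> {f} [i|g Hg|f g _ cf _ cg|f g _ cf _ cg] x.
- exact: coord_continuous.
- apply: (continuous_comp (f := fun x : 'rV[R]_n => dotp x x)).
    exact: dotp_continuous.
  exact: Coo_continuous.
- by apply: continuousD; [exact: cf|exact: cg].
- by apply: continuousM; [exact: cf|exact: cg].
Qed.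

Lemma Rad_is_derive f i : Rad f ->
  exists2 f' : 'rV[R]_n -> R, (forall x, is_derive x (evec i) f (f' x)) & Rad f'.
Proof.
elim=> {f} [j|g Hg|f g Rf [f' df Rf'] Rg [g' dg Rg']|f g Rf [f' df Rf'] Rg [g' dg Rg']].
- exists (fun=> (j == i)%:R); last exact: Rad_cst.
  by move=> x; exact: is_derive_coord.
- have [g' dg Hg'] := Coo_is_derive Hg.
  exists (fun x => g' (dotp x x) * (2 * x ord0 i)).
    by move=> x; exact: is_derive_radial.
  apply: Rad_mul; first exact: Rad_radial.
  by apply: Rad_mul; [exact: Rad_cst|exact: Rad_coord].
- exists (fun x => f' x + g' x); last exact: Rad_add.
  by move=> x; exact: is_deriveD.
- exists (fun x => f x * g' x + g x * f' x).
    by move=> x; exact: is_deriveM.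
  by apply: Rad_add; exact: Rad_mul.
Qed.

Lemma Rad_smooth f : Rad f -> smooth f.
Proof.
move=> Rf s.
have {Rf}Rg : Rad (foldr partial f s).
  elim: s => // i s /(Rad_is_derive i)[f' df Rf'].
  rewrite /= (_ : partial _ _ = f')//; apply/funext => x.
  by have [_ <-] := df x.
split; first exact: Rad_continuous.
by move=> i x; have [f' df _] := Rad_is_derive i Rg; have [] := df x.
Qed.

Lemma radial_test_function (eta : R -> R) (b : R) : b < 1 -> Coo eta ->
  (forall s, b <= s -> eta s = 0) ->
  test_function (fun x : 'rV[R]_n => eta (dotp x x)).
Proof.
move=> b1 Heta eta0.
have sub : closure [set x : 'rV[R]_n | eta (dotp x x) != 0] `<=`
    [set x | dotp x x <= b].
  have cl : closed [set x : 'rV[R]_n | dotp x x <= b].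
    by apply: compact_closed; [exact: norm_hausdorff|exact: compact_ballsq].
  rewrite [X in _ `<=` X](closure_id _).1//; apply: closure_subset => x /=.
  by apply: contraNle => /ltW/eta0 ->; rewrite eqxx.
split.
- by apply: Rad_smooth; exact: (@Rad_radial eta).
- apply: subclosed_compact sub; [exact: closed_closure|exact: compact_ballsq].
- by move=> x /sub /= xb; apply/uballE; exact: le_lt_trans b1.
Qed.

Lemma test_function_partial f i x : test_function f ->
  is_derive x (evec i) f (partial i f x).
Proof.
move=> [sm _ _]; have [_ H] := sm [::]; exact/derivableP/H.
Qed.

Lemma test_function_continuous f : test_function f -> continuous f.
Proof. by move=> [sm _ _]; have [] := sm [::]. Qed.

Lemma test_function_partial_continuous f i : test_function f -> continuous (partial i f).
Proof. by move=> [sm _ _]; have [] := sm [:: i]. Qed.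

(** On the compact support |x|^2 attains a maximum, below 1; if the support is empty, b = 0
    serves. *)
Lemma test_function_support f : test_function f ->
  exists2 b : R, 0 <= b < 1 & forall x, b < dotp x x -> f x = 0.
Proof.
move=> [_ cK KU]; set K := closure _ in cK KU.
have [[x0 Kx0]|K0] := pselect (K !=set0); last first.
  exists 0; rewrite ?lexx ?ltr01// => x _; apply/eqP/negPn/negP => fx.
  by apply: K0; exists x; apply: subset_closure.
have [||c cK' H] := @EVT_max_rV R n (fun x => dotp x x) K _ cK.
- by exists x0.
- exact: continuous_subspaceT dotp_continuous.
exists (dotp c c).
  by rewrite dotp_ge0/=; apply/uballE/KU; rewrite inE in cK'.
move=> x; apply: contra_ltP => /eqP fx; apply: H; rewrite inE.
exact: subset_closure.
Qed.

End Directional.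

(** * The divergence theorem in the ball *)

Section Divergence.
Context {R : realType} {n : nat}.
Local Notation mR := (measurableTypeR R).
Local Notation lam := (@lebesgue_tuple R n).
Local Notation X := (@vec_of_tuple R n).
Local Notation D := (@uball_tuple R n).

Lemma integrable_ball_continuous (f : 'rV[R]_n -> R) : continuous f ->
  lam.-integrable D (EFin \o (fun t => f (X t))).
Proof.
move=> cf; have [C C0 HC] := bounded_on_ball cf.
apply: (@integrable_bounded R n _ _ 1 C) => //.
- exact: measurable_uball_tuple.
- exact: uball_tuple_sub_cube.
- exact: measurable_funTS (measurable_continuous_vec cf).
- move=> t; rewrite uball_tupleE /= => t1; apply: HC.
  by rewrite dotp_vec_of_tuple ltW.
Qed.

Lemma upd_vec (t : n.-tuple mR) i (s : R) :
  X (upd t i s) = s *: evec i + X (upd t i 0).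
Proof.
apply/rowP => j; rewrite !mxE !tnth_mktuple eqxx /=.
by case: eqP => _; rewrite ?mulr1 ?addr0 ?mulr0 ?add0r.
Qed.

Lemma integral_partial_vec (f df : 'rV[R]_n -> R) i :
  (forall x, is_derive x (evec i) f (df x)) -> continuous df ->
  (forall x, 1 <= dotp x x -> f x = 0) -> (forall x, 1 <= dotp x x -> df x = 0) ->
  (\int[lam]_(t in D) (df (X t)))%R = 0.
Proof.
move=> dfE cdf f0 df0.
have [C C0 HC] := bounded_on_ball cdf.
suff : (\int[lam]_t (df (X t))%:E = 0)%E.
  move=> E; rewrite /Rintegral integral_mkcond.
  rewrite [X in fine X](_ : _ = 0%E)// -[RHS]E; apply: eq_integral => t _.
  rewrite patchE; case: ifPn => //; rewrite notin_setE uball_tupleE /= => /negP.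
  by rewrite -leNgt -dotp_vec_of_tuple => /df0 ->.
apply: (@integral_partial R n i (f \o X) (df \o X) 1 C) => //.
- exact: measurable_continuous_vec.
- move=> t /=; have [t1|/ltW t1] := leP (dotp (X t) (X t)) 1; first exact: HC.
  by rewrite df0// normr0.
- move=> t tM /=; apply: df0; rewrite leNgt; apply/negP => t1; apply: tM.
  by apply: uball_tuple_sub_cube; rewrite uball_tupleE /= -dotp_vec_of_tuple.
- move=> t s /=; rewrite (upd_vec t i s).
  rewrite [X in is_derive _ _ X](_ : _ = fun h : R => f (h *: evec i + X (upd t i 0))).
    by apply: (is_derive_line (f := f)); exact: dfE.
  by apply/funext => h; rewrite upd_vec.
- move=> t; rewrite [X in continuous X](_ : _ = fun h : R => df (h *: evec i + X (upd t i 0))).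
    move=> h; apply: (continuous_comp (f := fun h : R => h *: evec i + X (upd t i 0))).
      by apply: continuousD; [exact: scalel_continuous|exact: cst_continuous].
    exact: cdf.
  by apply/funext => h; rewrite /= upd_vec.
- move=> t s s1 /=; apply: f0; rewrite dotp_vec_of_tuple.
  apply: le_trans (sqr_tnth_le _ i); rewrite tnth_mktuple eqxx -real_normK ?num_real//.
  by rewrite expr2 -[leLHS]mulr1 ler_pM.
Qed.

Lemma Rintegral_sum (I : Type) (r : seq I) (f : I -> n.-tuple mR -> R) :
  (forall i, lam.-integrable D (EFin \o f i)) ->
  lam.-integrable D (EFin \o (fun t => \sum_(i <- r) f i t)) /\
  (\int[lam]_(t in D) (\sum_(i <- r) f i t))%R = \sum_(i <- r) (\int[lam]_(t in D) f i t)%R.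
Proof.
move=> fi; have mD := @measurable_uball_tuple R n.
elim: r => [|i r [IH1 IH2]].
  have -> : (fun t => \sum_(i <- [::]) f i t) = (fun=> 0).
    by apply/funext => t; rewrite big_nil.
  rewrite big_nil; split; last by rewrite Rintegral_cst// mul0r.
  by apply: eq_integrable (integrable0 _ _) => //.
rewrite big_cons -IH2 -RintegralD//; split; last first.
  by apply: eq_Rintegral => t _; rewrite big_cons.
have := integrableD mD (fi i) IH1; apply: eq_integrable => // t _.
by rewrite /= big_cons EFinD.
Qed.

(* Integration of the divergence of [f x * k (|x| ^ 2) *: x]. *)
Lemma radial_divergence (f : 'rV[R]_n -> R) (k k' : R -> R) b : test_function f ->
  Coo k -> (forall s : R, is_derive s 1 k (k' s)) -> b < 1 ->
  (forall s, b <= s -> k s = 0) ->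
  (\int[lam]_(t in D) (\sum_(i < n) partial i f (X t) * tnth t i * k (normsq t)))%R =
  - (\int[lam]_(t in D) (f (X t) * (n%:R * k (normsq t) + 2 * normsq t * k' (normsq t))))%R.
Proof.
move=> tf kC dk b1 k0.
have k'C := Coo_derive dk kC.
have k'0 s : 1 <= s -> k' s = 0.
  move=> s1; apply: is_derive_unique (dk s) _.
  apply: (is_derive_near (f := fun=> 0)).
  exists (1 - b); first by rewrite /= subr_gt0.
  move=> y; rewrite /ball/= ltr_norml => /andP[_ ys]; rewrite k0//.
  by move: ys; rewrite ltrBlDr -ltrBlDl; move: s1; lra.
pose df i x := partial i f x * (x ord0 i * k (dotp x x)) +
  f x * (k (dotp x x) + x ord0 i * (k' (dotp x x) * (2 * x ord0 i))).
have ck : continuous (fun x : 'rV[R]_n => k (dotp x x)).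
  exact: Rad_continuous (Rad_radial kC).
have ck' : continuous (fun x : 'rV[R]_n => k' (dotp x x)).
  exact: Rad_continuous (Rad_radial k'C).
have cf : continuous f by exact: test_function_continuous.
have cpf i : continuous (partial i f) by exact: test_function_partial_continuous.
have cx i : continuous (fun x : 'rV[R]_n => x ord0 i) by exact: coord_continuous.
have cdf i : continuous (df i).
  move=> x.
  have H1 : {for x, continuous (fun y : 'rV[R]_n => y ord0 i * k (dotp y y))}.
    by apply: continuousM; [exact: cx|exact: ck].
  have H2 : {for x, continuous (fun y : 'rV[R]_n =>
      k (dotp y y) + y ord0 i * (k' (dotp y y) * (2 * y ord0 i)))}.
    apply: continuousD; first exact: ck.
    apply: continuousM; first exact: cx.
    apply: continuousM; first exact: ck'.
    by apply: continuousM; [exact: cst_continuous|exact: cx].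
  exact: (continuousD (continuousM (cpf i x) H1) (continuousM (cf x) H2)).
have idf i : (\int[lam]_(t in D) (df i (X t)))%R = 0.
  apply: (@integral_partial_vec (fun x => f x * (x ord0 i * k (dotp x x))) (df i) i) => //.
  - move=> x.
    have d1 := test_function_partial i x tf.
    have d2 := is_derive_coord x i i.
    have d3 := is_derive_radial x i dk.
    have d4 := is_deriveM d1 (is_deriveM d2 d3).
    apply: is_derive_eq d4 _.
    rewrite eqxx /df /GRing.scale/= !fctE; ring.
  - by move=> x x1; rewrite k0 ?mulr0// (le_trans (ltW b1)).
  - move=> x x1; rewrite /df k'0// k0 ?(le_trans (ltW b1))//.
    by rewrite !(mulr0, mul0r, addr0).
have idfi i : lam.-integrable D (EFin \o (fun t => df i (X t))).
  exact: integrable_ball_continuous.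
have [_ E] := Rintegral_sum (index_enum 'I_n) idfi.
rewrite [RHS](_ : _ = 0) in E; last by rewrite big1.
have i1 : lam.-integrable D (EFin \o (fun t =>
    \sum_(i < n) partial i f (X t) * tnth t i * k (normsq t))).
  have [|H _] := @Rintegral_sum 'I_n (index_enum 'I_n)
      (fun i t => partial i f (X t) * tnth t i * k (normsq t)); last exact: H.
  move=> i; rewrite [X in _.-integrable D X](_ : _ = EFin \o (fun t =>
     (fun x : 'rV[R]_n => partial i f x * (x ord0 i * k (dotp x x))) (X t))).
    apply: (@integrable_ball_continuous (fun x => partial i f x * (x ord0 i * k (dotp x x)))) => x.
    apply: continuousM; first exact: cpf.
    by apply: continuousM; [exact: cx|exact: ck].
  by apply/funext => t /=; rewrite mxE dotp_vec_of_tuple mulrA.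
have i2 : lam.-integrable D (EFin \o (fun t =>
    f (X t) * (n%:R * k (normsq t) + 2 * normsq t * k' (normsq t)))).
  rewrite [X in _.-integrable D X](_ : _ = EFin \o (fun t =>
     (fun x : 'rV[R]_n => f x * (n%:R * k (dotp x x) + 2 * dotp x x * k' (dotp x x))) (X t))).
    apply: (@integrable_ball_continuous (fun x => f x *
       (n%:R * k (dotp x x) + 2 * dotp x x * k' (dotp x x)))) => x.
    have H1 : {for x, continuous (fun y : 'rV[R]_n => n%:R * k (dotp y y))}.
      by apply: continuousM; [exact: cst_continuous|exact: ck].
    have H2 : {for x, continuous (fun y : 'rV[R]_n => 2 * dotp y y)}.
      by apply: continuousM; [exact: cst_continuous|exact: dotp_continuous].
    exact: (continuousM (cf x) (continuousD H1 (continuousM H2 (ck' _)))).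
  by apply/funext => t /=; rewrite dotp_vec_of_tuple.
apply/eqP; rewrite -addr_eq0 -RintegralD//; last exact: measurable_uball_tuple.
apply/eqP; rewrite -[RHS]E; apply: eq_Rintegral => t _.
rewrite /df big_split/=; congr (_ + _).
  by apply: eq_bigr => i _; rewrite mxE dotp_vec_of_tuple mulrA.
rewrite -mulr_sumr; congr (_ * _); rewrite big_split/= sumr_const card_ord.
rewrite -dotp_vec_of_tuple; congr (_ + _); first by rewrite mulr_natl.
set c := k' _; rewrite /dotp mulr_sumr mulr_suml; apply: eq_bigr => i _; ring.
Qed.

End Divergence.

(** * The weak equation tested with radial functions *)

(** A substitute for the Cauchy-Schwarz inequality: the bound with a free parameter s is Young's
    inequality, where the integral of Q n tends to 0 and that of q is finite. It also yields the
    integrability of h n for large n. *)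
Lemma vanishing_Rintegral d (T : measurableType d) (R : realType)
    (mu : {measure set T -> \bar R}) (D : set T) (h Q : nat -> T -> R) (q : T -> R) :
  measurable D ->
  (forall n, measurable_fun D (h n)) -> (forall n, measurable_fun D (Q n)) ->
  measurable_fun D q ->
  (forall n t, D t -> 0 <= Q n t) -> (forall t, D t -> 0 <= q t) ->
  (forall n t s, D t -> 0 < s -> `|h n t| <= s * Q n t + s^-1 * q t) ->
  (\int[mu]_(t in D) (Q n t)%:E)%E @[n --> \oo] --> 0%E ->
  (\int[mu]_(t in D) (q t)%:E < +oo)%E ->
  forall e : R, 0 < e -> exists n0, forall n, (n0 <= n)%N ->
    mu.-integrable D (EFin \o h n) /\ `|(\int[mu]_(t in D) h n t)%R| <= e.
Proof.
move=> mD mh mQ mq Q0 q0 hQ cQ qoo e e0.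
pose I := (\int[mu]_(t in D) q t)%R.
have I0 : 0 <= I by apply: Rintegral_ge0.
(* Makes the q term at most e / 2; the 1 keeps s positive when I = 0. The Q term is then at most e /
   2 for large n. *)
pose s := 2 * (I + 1) / e.
have s0 : 0 < s by rewrite divr_gt0// mulr_gt0// ltr_wpDl.
have iq : mu.-integrable D (EFin \o q).
  apply/integrableP; split; first exact/measurable_EFinP.
  rewrite (eq_integral (fun t => (q t)%:E)) => // t; rewrite inE => tD.
  by rewrite /= ger0_norm ?q0.
have d0 : 0 < e / (2 * s) by rewrite divr_gt0// mulr_gt0.
move: cQ => /fine_cvgP[[n1 _ fQ] /cvgrPdist_lt /(_ _ d0)[n2 _ Qs]].
exists (maxn n1 n2) => n; rewrite geq_max => /andP[n1n n2n].
have iQ : mu.-integrable D (EFin \o Q n).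
  apply/integrableP; split; first exact/measurable_EFinP.
  rewrite (eq_integral (fun t => (Q n t)%:E)); last first.
    by move=> t; rewrite inE => tD; rewrite /= ger0_norm ?Q0.
  have := fQ n n1n; rewrite /= ge0_fin_numE//.
  by apply: integral_ge0 => t tD; rewrite lee_fin Q0.
have isQ : mu.-integrable D (EFin \o (fun t => s * Q n t)).
  by have := integrableZl mD s iQ; apply: eq_integrable.
have isq : mu.-integrable D (EFin \o (fun t => s^-1 * q t)).
  by have := integrableZl mD s^-1 iq; apply: eq_integrable.
have iS : mu.-integrable D (EFin \o (fun t => s * Q n t + s^-1 * q t)).
  by have := integrableD mD isQ isq; apply: eq_integrable.
have S0 t : D t -> 0 <= s * Q n t + s^-1 * q t.
  move=> tD; apply: addr_ge0; apply: mulr_ge0; rewrite ?invr_ge0 ?(ltW s0)//.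
    exact: Q0.
  exact: q0.
have ih : mu.-integrable D (EFin \o h n).
  apply: le_integrable iS => //; first exact/measurable_EFinP.
  by move=> t tD; rewrite /= lee_fin [leRHS]ger0_norm ?S0// hQ.
split => //; apply: le_trans (le_normr_Rintegral mD ih) _.
apply: (@le_trans _ _ (\int[mu]_(t in D) (s * Q n t + s^-1 * q t))%R).
  apply: le_Rintegral => //; last by move=> t tD; exact: hQ.
  by have := integrable_abse ih; apply: eq_integrable.
rewrite RintegralD// !RintegralZl// -/I.
have QI : (\int[mu]_(t in D) Q n t)%R < e / (2 * s).
  by have := Qs n n2n; rewrite /= sub0r normrN; exact/le_lt_trans/ler_norm.
have : s * (\int[mu]_(t in D) Q n t)%R <= s * (e / (2 * s)).
  by rewrite ler_pM2l// ltW.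
have -> : s * (e / (2 * s)) = e / 2 by field; rewrite gt_eqF.
have : s^-1 * I <= e / 2.
  rewrite /s invf_div mulrAC ler_pdivrMr ?mulr_gt0 ?ltr_wpDl//.
  have -> : e / 2 * (2 * (I + 1)) = e * (I + 1) by field.
  by rewrite ler_pM2l// lerDl.
lra.
Qed.

Section WeakRadial.
Context {R : realType} {n : nat}.
Hypothesis n_gt1 : (1 < n)%N.
Local Notation mR := (measurableTypeR R).
Local Notation lam := (@lebesgue_tuple R n).
Local Notation X := (@vec_of_tuple R n).
Local Notation D := (@uball_tuple R n).
Implicit Types (x Y Z : 'rV[R]_n) (s : R).

Definition cfactor (s : R) : R := 2 / (1 - s).

Lemma conf_cfactor x : conf x = cfactor (dotp x x).
Proof. by rewrite /conf /enorm sqr_sqrtr// dotp_ge0. Qed.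

Lemma conf_tuple t : conf (X t) = cfactor (normsq t).
Proof. by rewrite conf_cfactor dotp_vec_of_tuple. Qed.

Lemma cfactor_gt0 s : s < 1 -> 0 < cfactor s.
Proof. by move=> s1; rewrite divr_gt0// subr_gt0. Qed.

Lemma cfactor_continuous s : s < 1 -> {for s, continuous cfactor}.
Proof.
move=> s1; apply: (@is_derive_cvg R _ _ (2 * (1 - s) ^- 2)); rewrite /cfactor.
have s0 : 1 - s != 0 by rewrite gt_eqF// subr_gt0.
by der => //; ring.
Qed.

Lemma continuousX1 (f : R -> R) m s : {for s, continuous f} ->
  {for s, continuous (fun y => f y ^+ m)}.
Proof.
move=> cf; exact: (@continuous_comp _ _ _ f (fun y => y ^+ m) s cf (@exprn_continuous R m _)).
Qed.

Lemma young (a b s : R) : 0 < s -> `|a * b| <= s * a ^+ 2 + s^-1 * b ^+ 2.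
Proof.
move=> s0; rewrite -(ler_pM2l s0) mulrDr.
have -> : s * (s^-1 * b ^+ 2) = b ^+ 2 by field; rewrite gt_eqF.
rewrite -{1}(gtr0_norm s0) -normrM ler_norml.
have H1 := sqr_ge0 (s * a + b); have H2 := sqr_ge0 (s * a - b).
have H3 := sqr_ge0 (s * a); have H4 := sqr_ge0 b.
by move: H1 H2 H3 H4; rewrite !expr2 => *; apply/andP; split; lra.
Qed.

Lemma metric_young x Y Z s : 0 < s ->
  `|metric x Y Z| <= s * metric x Y Y + s^-1 * metric x Z Z.
Proof.
move=> s0; rewrite /metric normrM (ger0_norm (sqr_ge0 _)).
have -> : s * (conf x ^+ 2 * dotp Y Y) + s^-1 * (conf x ^+ 2 * dotp Z Z) =
  conf x ^+ 2 * (s * dotp Y Y + s^-1 * dotp Z Z) by ring.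
apply: ler_wpM2l; first exact: sqr_ge0.
rewrite /dotp !mulr_sumr -big_split/=; apply: le_trans (ler_norm_sum _ _ _) _.
by apply: ler_sum => i _; have := young (Y ord0 i) (Z ord0 i) s0; rewrite !expr2.
Qed.

Lemma metricBl x Y1 Y2 Z : metric x (Y1 - Y2) Z = metric x Y1 Z - metric x Y2 Z.
Proof.
rewrite /metric -mulrBr; congr (_ * _); rewrite /dotp -sumrB.
by apply: eq_bigr => i _; rewrite !mxE mulrBl.
Qed.

Lemma metric_ge0 x Y : 0 <= metric x Y Y.
Proof. by rewrite mulr_ge0 ?sqr_ge0// dotp_ge0. Qed.

Lemma measurable_cfactor m : measurable_fun D (fun t => conf (X t) ^+ m).
Proof.
under eq_fun do rewrite conf_tuple.
apply: (@measurable_radial R n (fun s => cfactor s ^+ m)) => // s s1.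
exact/continuousX1/cfactor_continuous.
Qed.

Lemma measurable_metric (Y Z : 'rV[R]_n -> 'rV[R]_n) :
  (forall i, measurable_on_ball (fun x => Y x ord0 i)) ->
  (forall i, measurable_on_ball (fun x => Z x ord0 i)) ->
  measurable_fun D (fun t => conf (X t) ^+ n * metric (X t) (Y (X t)) (Z (X t))).
Proof.
move=> mY mZ; apply: measurable_funM; first exact: measurable_cfactor.
apply: measurable_funM; first exact: measurable_cfactor.
by apply: measurable_sum => i; apply: measurable_funM; [exact: mY|exact: mZ].
Qed.

Lemma measurable_hgrad (f : 'rV[R]_n -> R) : test_function f ->
  forall i, measurable_on_ball (fun x => hgrad f x ord0 i).
Proof.
move=> tf i; rewrite /measurable_on_ball.
rewrite (_ : _ \o _ = fun t => (cfactor (normsq t) ^+ 2)^-1 * partial i f (X t)); last first.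
  by apply/funext => t; rewrite /= !mxE conf_tuple.
apply: measurable_funM.
  apply: (@measurable_radial R n (fun s => (cfactor s ^+ 2)^-1)) => // s s1.
  apply: continuousV; first by rewrite expf_neq0// gt_eqF// cfactor_gt0.
  exact/continuousX1/cfactor_continuous.
apply: measurable_funTS; apply: measurable_continuous_vec.
exact: test_function_partial_continuous.
Qed.

Variables (U : R -> R) (w : 'rV[R]_n -> R) (G : 'rV[R]_n -> 'rV[R]_n).
Hypothesis wU : forall x, uball x -> w x = U (dotp x x).
Hypothesis cU : forall s, s < 1 -> {for s, continuous U}.
Hypothesis HG : H1_gradient w G.

(** For each approximation phi, the metric product with the gradient of eta(|x|^2) integrates to
    that of k(|x|^2) x . grad phi, hence to an integral of phi by the divergence theorem. The limit
    puts G on the left and w on the right; the equation then replaces the term in G. *)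
Lemma radial_weak (rhs k k' eta : R -> R) (b : R) : 0 <= b < 1 ->
  Coo k -> (forall s, is_derive s 1 k (k' s)) -> (forall s, b <= s -> k s = 0) ->
  Coo eta ->
  (forall s, is_derive s 1 eta (k s * ((1 - s) ^+ (n - 2) / 2 ^+ (n - 1)))) ->
  (forall s, b <= s -> eta s = 0) ->
  (forall s, s < 1 -> {for s, continuous (fun s => rhs (U s))}) ->
  hintegral (fun x => metric x (G x) (hgrad (fun x => eta (dotp x x)) x)) =
    hintegral (fun x => rhs (w x) * eta (dotp x x)) ->
  radint n (fun s => U s * (n%:R * k s + 2 * s * k' s)) b =
  - radint n (fun s => cfactor s ^+ n * (rhs (U s) * eta s)) b.
Proof.
move=> b01 kC dk k0 etaC deta eta0 crhs Heq.
have b1 : b < 1 by case/andP: b01.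
have [mw mG [phi [tphi cphi cgrad]]] := HG.
have mD := @measurable_uball_tuple R n.
pose Phi x := eta (dotp x x).
have tPhi : test_function Phi by exact: radial_test_function b1 etaC eta0.
pose eta' s := k s * ((1 - s) ^+ (n - 2) / 2 ^+ (n - 1)).
have eta'C : Coo eta' by exact: Coo_derive deta etaC.
have ck s : {for s, continuous k} by exact: Coo_continuous kC s.
have ck' s : {for s, continuous k'} by exact: Coo_continuous (Coo_derive dk kC) s.
have ceta s : {for s, continuous eta} by exact: Coo_continuous etaC s.
have ceta' s : {for s, continuous eta'} by exact: Coo_continuous eta'C s.
have k'0 s : b < s -> k' s = 0.
  move=> bs; apply: is_derive_unique (dk s) _.
  apply: (is_derive_near (f := fun=> 0)).
  exists (s - b); first by rewrite /= subr_gt0.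
  move=> y; rewrite /ball/= ltr_norml => /andP[_ ys]; rewrite k0//.
  by move: ys; rewrite ltrD2l ltrN2 => /ltW.
have gradPhi x i : partial i Phi x = eta' (dotp x x) * (2 * x ord0 i).
  by have [_ <-] := is_derive_radial x i deta.
have Dlt t : D t -> normsq t < 1 by rewrite uball_tupleE.
pose kap s := n%:R * k s + 2 * s * k' s.
have ckap s : {for s, continuous kap}.
  apply: (@continuousD _ _ _ (fun s => n%:R * k s) (fun s => 2 * s * k' s)).
    by apply: continuousM; [exact: cst_continuous|exact: ck].
  apply: continuousM; last exact: ck'.
  by apply: continuousM; [exact: cst_continuous|exact: cvg_id].
pose A m t := \sum_(i < n) partial i (phi m) (X t) * tnth t i * k (normsq t).
pose Aoo t := conf (X t) ^+ n * metric (X t) (G (X t)) (hgrad Phi (X t)).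
(* The weight in eta' comes from here: conf^n conf^2 conf^-4 times 2 eta' is exactly k. *)
have AE m t : D t -> A m t =
    conf (X t) ^+ n * metric (X t) (hgrad (phi m) (X t)) (hgrad Phi (X t)).
  move=> /Dlt t1; have c0 := cfactor_gt0 t1.
  rewrite /A /metric /dotp mulr_sumr mulr_sumr; apply: eq_bigr => i _.
  rewrite /hgrad /egrad !mxE gradPhi mxE dotp_vec_of_tuple conf_tuple /eta'.
  have nE : n = (n - 2).+2 by rewrite -addn2 subnK.
  have -> : (n - 1)%N = (n - 2).+1 by rewrite {1}nE subn1.
  have cn (c : R) : c ^+ n = c * (c * c ^+ (n - 2)) by rewrite {1}nE !exprS.
  rewrite cn [2 ^+ (n - 2).+1]exprS; set m' := (n - 2)%N.
  have s0 : 1 - normsq t != 0 by rewrite gt_eqF// subr_gt0.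
  have -> : (1 - normsq t) ^+ m' = 2 ^+ m' * (cfactor (normsq t) ^+ m')^-1.
    by rewrite /cfactor expr_div_n invf_div mulrC divfK// expf_neq0.
  have c0' : cfactor (normsq t) != 0 by rewrite gt_eqF.
  field.
  by rewrite !expf_neq0.
pose Q m t := conf (X t) ^+ n * (let W := hgrad (phi m) (X t) - G (X t) in
   metric (X t) W W).
(* The weighted squared norm of the gradient of Phi as a function of s = |x|^2. It vanishes beyond
   b, so its integral is finite. *)
pose gq s := cfactor s ^+ n * (cfactor s ^+ 2 *
   ((cfactor s ^+ 2)^-1 ^+ 2 * (4 * s * eta' s ^+ 2))).
have gqE t : D t -> conf (X t) ^+ n * metric (X t) (hgrad Phi (X t)) (hgrad Phi (X t)) =
    gq (normsq t).
  move=> _; rewrite /gq /metric /dotp conf_tuple; congr (_ * (_ * _)).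
  rewrite -dotp_vec_of_tuple /dotp mulr_sumr mulr_suml mulr_sumr.
  by apply: eq_bigr => i _; rewrite /hgrad /egrad !mxE gradPhi mxE conf_tuple
    -dotp_vec_of_tuple /dotp; ring.
have cgq s : s < 1 -> {for s, continuous gq}.
  move=> s1; have cc := cfactor_continuous s1.
  have c2 := continuousX1 (m := 2) cc.
  have c2V : {for s, continuous (fun y => (cfactor y ^+ 2)^-1)}.
    by apply: continuousV => //; rewrite expf_neq0// gt_eqF// cfactor_gt0.
  have c4 : {for s, continuous (fun y : R => 4 * y)}.
    by apply: continuousM; [exact: cst_continuous|exact: cvg_id].
  exact: (continuousM (continuousX1 (m := n) cc) (continuousM c2 (continuousM
    (continuousX1 (m := 2) c2V) (continuousM c4 (continuousX1 (m := 2) (ceta' s)))))).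
have gq0 s : b < s < 1 -> gq s = 0.
  by move=> /andP[/ltW bs _]; rewrite /gq /eta' k0// mul0r expr0n !mulr0.
have small1 := @vanishing_Rintegral _ _ R lam D (fun m t => A m t - Aoo t) Q
  (fun t => conf (X t) ^+ n * metric (X t) (hgrad Phi (X t)) (hgrad Phi (X t))) mD.
have mAc m : continuous (fun x : 'rV[R]_n =>
    \sum_(i < n) partial i (phi m) x * x ord0 i * k (dotp x x)).
  move=> x; rewrite (_ : (fun x => _) =
      \sum_(i < n) (fun x : 'rV[R]_n => partial i (phi m) x * x ord0 i * k (dotp x x))).
    elim/big_ind : _ => [|f g cf cg|i _]; [exact: cst_continuous|exact: continuousD|].
    have c1 : {for x, continuous (partial i (phi m))}.
      exact: test_function_partial_continuous.
    have c2 : {for x, continuous (fun y : 'rV[R]_n => y ord0 i)}.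
      exact: coord_continuous.
    have c3 : {for x, continuous (fun y : 'rV[R]_n => k (dotp y y))}.
      exact: (Rad_continuous (Rad_radial kC)).
    exact: (continuousM (continuousM c1 c2) c3).
  by apply/funext => y; rewrite fct_sumE.
have AX m : (A m) = fun t => (fun x : 'rV[R]_n =>
    \sum_(i < n) partial i (phi m) x * x ord0 i * k (dotp x x)) (X t).
  apply/funext => t; apply: eq_bigr => i _.
  by rewrite mxE dotp_vec_of_tuple.
have mA m : measurable_fun D (A m).
  by rewrite AX; apply: measurable_funTS; exact: measurable_continuous_vec (mAc m).
have iA m : lam.-integrable D (EFin \o A m).
  by rewrite AX; exact: integrable_ball_continuous (mAc m).
have mAoo : measurable_fun D Aoo.
  by apply: measurable_metric => //; exact: measurable_hgrad.
have {}small1 := small1 (fun m => measurable_funB (mA m) mAoo).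
have mQ m : measurable_fun D (Q m).
  apply: (measurable_metric (Y := fun x => hgrad (phi m) x - G x)
    (Z := fun x => hgrad (phi m) x - G x)) => i;
  rewrite /measurable_on_ball (_ : _ \o _ = (fun t => ((fun x => hgrad (phi m) x ord0 i) \o X) t
     - ((fun x => G x ord0 i) \o X) t));
  [by apply: measurable_funB; [exact: measurable_hgrad|exact: mG] |
   by apply/funext => t; rewrite /= !mxE |
   by apply: measurable_funB; [exact: measurable_hgrad|exact: mG] |
   by apply/funext => t; rewrite /= !mxE].
have conf0 t : D t -> 0 < conf (X t) ^+ n.
  by move=> /Dlt t1; rewrite conf_tuple exprn_gt0// cfactor_gt0.
have {}small1 := small1 mQ (measurable_metric (measurable_hgrad tPhi) (measurable_hgrad tPhi)).
have {small1}small1 : forall e : R, 0 < e -> exists n0, forall m, (n0 <= m)%N ->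
    lam.-integrable D (EFin \o (fun t => A m t - Aoo t)) /\
    `|(\int[lam]_(t in D) (A m t - Aoo t))%R| <= e.
  apply: small1.
  - by move=> m t tD; rewrite mulr_ge0 ?metric_ge0 ?ltW ?conf0.
  - by move=> t tD; rewrite mulr_ge0 ?metric_ge0 ?ltW ?conf0.
  - move=> m t s tD s0; rewrite AE// /Aoo -mulrBr -metricBl normrM gtr0_norm ?conf0//.
    have H := metric_young (X t) (hgrad (phi m) (X t) - G (X t)) (hgrad Phi (X t)) s0.
    rewrite -(ler_pM2l (conf0 t tD)) in H; apply: le_trans H _.
    by rewrite /Q /= mulrDr (mulrCA _ s) (mulrCA _ s^-1).
  - exact: cgrad.
  - rewrite (eq_integral (fun t => (gq (normsq t))%:E)); last first.
      by move=> t; rewrite inE => tD; rewrite gqE.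
    by rewrite (integral_uball_radial n cgq b01)// ltry.
pose B m t := phi m (X t) * kap (normsq t).
pose Boo t := w (X t) * kap (normsq t).
pose Q' m t := conf (X t) ^+ n * (phi m (X t) - w (X t)) ^+ 2.
(* Convergence of phi m to w holds with the weight conf^n. Young's inequality with parameter s
   conf^n therefore leaves conf^-n kap^2 as the fixed term. *)
pose gB s := (cfactor s ^+ n)^-1 * kap s ^+ 2.
have kap0 s : b < s < 1 -> kap s = 0.
  by move=> /andP[bs _]; rewrite /kap k'0// k0 ?(ltW bs)// !mulr0 addr0.
have cgB s : s < 1 -> {for s, continuous gB}.
  move=> s1; apply: continuousM; last exact: continuousX1 (ckap s).
  apply: continuousV; first by rewrite expf_neq0// gt_eqF// cfactor_gt0.
  exact/continuousX1/cfactor_continuous.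
have mkap : measurable_fun D (fun t => kap (normsq t)).
  by apply: (@measurable_radial R n kap) => // s _; exact: ckap.
have mphi m : measurable_fun D (fun t => phi m (X t)).
  by apply: measurable_funTS; apply: measurable_continuous_vec;
    exact: test_function_continuous.
have mB m : measurable_fun D (B m) by exact: measurable_funM.
have mBoo : measurable_fun D Boo by exact: measurable_funM.
have mQ' m : measurable_fun D (Q' m).
  apply: measurable_funM; first exact: measurable_cfactor.
  by apply: measurable_funX; apply: measurable_funB; [exact: mphi|exact: mw].
have mgB : measurable_fun D (fun t => gB (normsq t)) by exact: (@measurable_radial R n gB).
have small2 : forall e : R, 0 < e -> exists n0, forall m, (n0 <= m)%N ->
    lam.-integrable D (EFin \o (fun t => B m t - Boo t)) /\
    `|(\int[lam]_(t in D) (B m t - Boo t))%R| <= e.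
  apply: (@vanishing_Rintegral _ _ R lam D _ Q' (fun t => gB (normsq t))) => //.
  - by move=> m; exact: measurable_funB.
  - by move=> m t tD; rewrite mulr_ge0 ?sqr_ge0// ltW// conf0.
  - move=> t tD; rewrite mulr_ge0 ?sqr_ge0// invr_ge0 exprn_ge0// ltW//.
    exact/cfactor_gt0/Dlt.
  - move=> m t s tD s0; rewrite /B /Boo -mulrBl.
    have c0 := conf0 t tD; have sc0 := mulr_gt0 s0 c0.
    apply: le_trans (young _ _ sc0) _.
    by rewrite /Q' /gB -conf_tuple invfM !mulrA.
  - rewrite (integral_uball_radial n cgB b01) ?ltry// => s bs.
    by rewrite /gB kap0// expr0n mulr0.
have iB m : lam.-integrable D (EFin \o B m).
  rewrite (_ : B m = fun t => (fun x : 'rV[R]_n => phi m x * kap (dotp x x)) (X t)).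
    apply: (@integrable_ball_continuous R n (fun x => phi m x * kap (dotp x x))) => x.
    have c1 : {for x, continuous (phi m)} by exact: test_function_continuous.
    have c2 : {for x, continuous (fun y : 'rV[R]_n => kap (dotp y y))}.
      apply: (continuous_comp (f := fun x : 'rV[R]_n => dotp x x)); last exact: ckap.
      exact: dotp_continuous.
    exact: (continuousM c1 c2).
  by apply/funext => t; rewrite dotp_vec_of_tuple.
have AB m : (\int[lam]_(t in D) A m t)%R = - (\int[lam]_(t in D) B m t)%R.
  exact: radial_divergence (tphi m) kC dk b1 k0.
(* Obtained as A m minus the difference A m - Aoo, which is integrable for large m; the same for
   Boo. *)
have iAoo : lam.-integrable D (EFin \o Aoo).
  have [m0 /(_ m0 (leqnn _))[i1 _]] := small1 _ ltr01.
  have := integrableB mD (iA m0) i1; apply: eq_integrable => // t _.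
  by rewrite /= -EFinB; congr EFin; ring.
have iBoo : lam.-integrable D (EFin \o Boo).
  have [m0 /(_ m0 (leqnn _))[i1 _]] := small2 _ ltr01.
  have := integrableB mD (iB m0) i1; apply: eq_integrable => // t _.
  by rewrite /= -EFinB; congr EFin; ring.
have AB0 : (\int[lam]_(t in D) Aoo t)%R + (\int[lam]_(t in D) Boo t)%R = 0.
  apply/eqP; rewrite -normr_eq0 eq_le normr_ge0 andbT.
  apply/ler_addgt0Pr => e e0; rewrite add0r.
  have e20 : 0 < e / 2 by rewrite divr_gt0.
  have [m1 H1] := small1 _ e20; have [m2 H2] := small2 _ e20.
  pose m := maxn m1 m2.
  have [_ +] := H1 m (leq_maxl _ _); have [_ +] := H2 m (leq_maxr _ _).
  rewrite !RintegralB// AB; move: (Rintegral _ _ (B m)) => Bm.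
  rewrite !ler_norml => /andP[? ?] /andP[? ?]; apply/andP; split; lra.
have BooE : (\int[lam]_(t in D) Boo t)%R = radint n (fun s => U s * kap s) b.
  apply: EFin_inj; rewrite -(@integral_uball_radial R n (fun s => U s * kap s) _ b b01).
  - rewrite /Rintegral fineK; last exact: integrable_fin_num.
    apply: eq_integral => t; rewrite inE => tD; rewrite /Boo wU ?dotp_vec_of_tuple//.
  - by move=> s s1; apply: continuousM; [exact: cU|exact: ckap].
  - by move=> s bs; rewrite kap0// mulr0.
have cF s : s < 1 -> {for s, continuous (fun s => cfactor s ^+ n * (rhs (U s) * eta s))}.
  move=> s1; apply: continuousM; first exact/continuousX1/cfactor_continuous.
  by apply: continuousM; [exact: crhs|exact: ceta].
have AooE : (\int[lam]_(t in D) Aoo t)%R =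
    radint n (fun s => cfactor s ^+ n * (rhs (U s) * eta s)) b.
  apply: EFin_inj; rewrite -(integral_uball_radial n cF b01); last first.
    by move=> s /andP[/ltW bs _]; rewrite eta0// !mulr0.
  rewrite /Rintegral fineK; last exact: integrable_fin_num.
  transitivity (hintegral (fun x => rhs (w x) * eta (dotp x x))); first exact: Heq.
  rewrite /hintegral; apply: eq_integral => t; rewrite inE => tD.
  by rewrite conf_tuple wU ?dotp_vec_of_tuple.
by rewrite -AooE; apply/eqP; rewrite -addr_eq0 addrC -AB0 BooE.
Qed.

(** A single approximation at finite distance suffices: w^2 <= 2 phi^2 + 2 (phi - w)^2, where phi is
    bounded and supported in |x|^2 <= b, a region on which the conformal factor is at most
    [cfactor b]. *)
Lemma radial_L2_bound : exists B : R, forall s, 0 <= s < 1 ->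
  radint n (fun s => cfactor s ^+ n * U s ^+ 2) s <= B.
Proof.
have [mw _ [phi [tphi cphi _]]] := HG.
have mD := @measurable_uball_tuple R n.
have Dlt t : D t -> normsq t < 1 by rewrite uball_tupleE.
have conf0 t : D t -> 0 < conf (X t) ^+ n.
  by move=> /Dlt t1; rewrite conf_tuple exprn_gt0// cfactor_gt0.
have [m fin] : exists m, (hintegral (fun x => ((phi m x - w x) ^+ 2)%R) < +oo)%E.
  move: cphi => /fine_cvgP[[m _ H] _]; exists m.
  by have := H m (leqnn _); rewrite /= fin_numE => /andP[_]; rewrite ltey.
have [b /andP[b0 b1] phi0] := test_function_support (tphi m).
have cphim : continuous (phi m) by exact: test_function_continuous.
have [C C0 HC] := bounded_on_ball cphim.
have mphi : measurable_fun D (fun t => phi m (X t)).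
  by apply: measurable_funTS; apply: measurable_continuous_vec;
    exact: test_function_continuous.
pose f1 t := conf (X t) ^+ n * phi m (X t) ^+ 2.
pose f2 t := conf (X t) ^+ n * (phi m (X t) - w (X t)) ^+ 2.
have mf1 : measurable_fun D f1.
  by apply: measurable_funM; [exact: measurable_cfactor|exact: measurable_funX].
have mf2 : measurable_fun D f2.
  apply: measurable_funM; first exact: measurable_cfactor.
  by apply: measurable_funX; exact: measurable_funB.
have i1 : lam.-integrable D (EFin \o f1).
  apply: (@integrable_bounded R n _ _ 1 (cfactor b ^+ n * C ^+ 2)) => //.
    exact: uball_tuple_sub_cube.
  move=> t tD; have t1 := Dlt _ tD; rewrite /f1 ger0_norm; last first.
    by rewrite mulr_ge0 ?sqr_ge0// ltW// conf0.
  have [tb|bt] := leP (normsq t) b; last first.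
    rewrite phi0 ?dotp_vec_of_tuple// expr0n mulr0 mulr_ge0 ?sqr_ge0//.
    by rewrite exprn_ge0// ltW// cfactor_gt0.
  apply: ler_pM; rewrite ?sqr_ge0//; first by rewrite ltW// conf0.
    have cle : cfactor (normsq t) <= cfactor b.
      by rewrite /cfactor ler_pM2l// lef_pV2 ?posrE ?subr_gt0// lerD2l lerN2.
    by rewrite conf_tuple; apply: lerXn2r => //; rewrite nnegrE ltW// cfactor_gt0.
  rewrite -real_normK ?num_real// lerXn2r ?nnegrE//.
  by apply: HC; rewrite dotp_vec_of_tuple ltW.
have i2 : lam.-integrable D (EFin \o f2).
  apply/integrableP; split; first exact/measurable_EFinP.
  rewrite (eq_integral (fun t => (f2 t)%:E)); first exact: fin.
  by move=> t; rewrite inE => tD; rewrite /= ger0_norm// mulr_ge0 ?sqr_ge0// ltW// conf0.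
have i3 : lam.-integrable D (EFin \o (fun t => 2 * f1 t + 2 * f2 t)).
  have := integrableD mD (integrableZl mD 2 i1) (integrableZl mD 2 i2).
  by apply: eq_integrable.
exists (\int[lam]_(t in D) (2 * f1 t + 2 * f2 t))%R => s s01.
have cF y : y < 1 -> {for y, continuous (fun s => cfactor s ^+ n * U s ^+ 2)}.
  move=> y1; apply: continuousM; first exact/continuousX1/cfactor_continuous.
  exact/continuousX1/cU.
rewrite -lee_fin.
apply: (le_trans (radint_le_uball n cF s01 _)).
  by move=> y /andP[_ y1]; rewrite mulr_ge0 ?sqr_ge0// exprn_ge0// ltW// cfactor_gt0.
rewrite /Rintegral fineK; last exact: integrable_fin_num.
apply: ge0_le_integral => //.
- by move=> t tD; rewrite lee_fin mulr_ge0 ?sqr_ge0// exprn_ge0// ltW// cfactor_gt0// Dlt.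
- by apply/measurable_EFinP; exact: (measurable_radial cF).
- by apply/measurable_EFinP; case/integrableP: i3 => /measurable_EFinP.
- move=> t tD; rewrite lee_fin -conf_tuple -dotp_vec_of_tuple -wU//.
  rewrite /f1 /f2 !(mulrCA 2) -mulrDr ler_pM2l ?conf0//.
  set a := phi m _; set c := w _.
  by have := sqr_ge0 (2 * a - c); rewrite !expr2; nra.
Qed.

End WeakRadial.

(** * The hyperbolic distance as a variable *)

Section RadialEquation.
Context {R : realType} {n : nat}.
Hypothesis n_gt1 : (1 < n)%N.
Variables (U rhs : R -> R) (w : 'rV[R]_n -> R) (G : 'rV[R]_n -> 'rV[R]_n).
Hypothesis wU : forall x, uball x -> w x = U (dotp x x).
Hypothesis cU : forall s : R, s < 1 -> {for s, continuous U}.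
Hypothesis crhs : forall s : R, s < 1 -> {for s, continuous (fun s => rhs (U s))}.
Hypothesis HG : H1_gradient w G.
Hypothesis Hweak : forall phi, test_function phi ->
  hintegral (fun x => metric x (G x) (hgrad phi x)) =
  hintegral (fun x => rhs (w x) * phi x).
Implicit Types (s a b e : R).

(** At s = tanh(rho/2)^2 this is n vol(1) times the integral of sinh^(n-1) f(v) from 0 to rho. *)
Definition forcing (s : R) : R := radint n (fun s => cfactor s ^+ n * rhs (U s)) s.

Let n_gt0 : (0 < n)%N. Proof. exact: ltnW. Qed.
Let nR : 0 < n%:R :> R. Proof. by rewrite ltr0n. Qed.
Local Notation V := (@vol R n).

Lemma vol_gt0 s : 0 < s -> 0 < V s.
Proof. by move=> s0; rewrite vol_scale// mulr_gt0 ?vol1_gt0// exprn_gt0// sqrtr_gt0. Qed.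

Lemma volD s : 0 < s -> is_derive s 1 V (n%:R / (2 * s) * V s).
Proof.
move=> s0; apply: der_eq (vol_derive n_gt0 s0) _.
by rewrite [in RHS]vol_scale//; ring.
Qed.

Lemma radintD g s : (forall s, s < 1 -> {for s, continuous g}) -> 0 < s < 1 ->
  is_derive s 1 (radint n g) (g s * (n%:R / (2 * s) * V s)).
Proof.
move=> cg s01; apply: der_eq (radint_derive n_gt0 cg s01) _.
by case/andP: s01 => s0 _; rewrite [in RHS]vol_scale//; ring.
Qed.

Lemma forcing_integrand_continuous s : s < 1 ->
  {for s, continuous (fun s => cfactor s ^+ n * rhs (U s))}.
Proof.
move=> s1; apply: continuousM; first exact/continuousX1/cfactor_continuous.
exact: crhs.
Qed.

Let cpol (s : R) : R := (1 - s) ^+ (n - 2) / 2 ^+ (n - 1).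

Let cpol_Coo : Coo cpol.
Proof.
move=> m; apply: CkM; last exact: Ck_cst.
have -> : (fun s : R => (1 - s) ^+ (n - 2)) = (fun s => ((-1) * s + 1) ^+ (n - 2)).
  by apply/funext => s; rewrite mulN1r addrC.
apply: CkX; exact: (Ck_affine (f := fun x => x) (-1) 1 (@Ck_id R m)).
Qed.

(** The weak equation has density U (n k + 2 s k') V'. As 2 s V' = n V, the coefficient of k' is n U
    V; that of k is n U V', corrected by the forcing term after an integration by parts. *)
Let A s := n%:R * U s * V s.
Let B s := n%:R * U s * (n%:R / (2 * s) * V s) - forcing s * cpol s.

Let AB_test (k k' : R -> R) (a b : R) : 0 < a -> a < b -> b < 1 ->
  Coo k -> (forall x : R, is_derive x 1 k (k' x)) ->
  (forall x, ~~ (a < x < b) -> k x = 0) ->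
  exists F, (forall x, a <= x <= b -> is_derive x 1 F (A x * k' x + B x * k x))
    /\ F a = F b.
Proof.
move=> a0 ab b1 kC dk k0.
have kl x : x <= a -> k x = 0 by move=> xa; rewrite k0// negb_and -leNgt xa.
have kr x : b <= x -> k x = 0 by move=> xb; rewrite k0// negb_and -!leNgt xb orbT.
have k'C := Coo_derive dk kC.
have kc s : {for s, continuous k} by exact: Coo_continuous kC s.
have k'c s : {for s, continuous k'} by exact: Coo_continuous k'C s.
(* At x = a itself k is known to vanish only to the left, so each sign of k' is excluded from that
   side. *)
have k'0 x : x <= a -> k' x = 0.
  move=> xa; apply/eqP; case: (ltgtP (k' x) 0) => // kx; exfalso.
    have [|d d0 Hd] := der_gt0_left (derN (dk x)); first by rewrite oppr_gt0.
    by have := Hd (x - d / 2); rewrite !kl ?ltxx; [lra|lra|lra].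
  have [d d0 Hd] := der_gt0_left (dk x) kx.
  by have := Hd (x - d / 2); rewrite !kl ?ltxx; [lra|lra|lra].
have [x|x xa|F0 HF0] := @primitive_left R (fun s => k s * cpol s) a.
- by apply: continuousM; [exact: kc|exact: Coo_continuous cpol_Coo x].
- by rewrite kl// mul0r.
(* Normalized to vanish beyond b, which gives compact support in the ball. To the left of a it is a
   constant, in general nonzero. *)
pose eta s := F0 s + - F0 b.
have deta s : is_derive s 1 eta (k s * cpol s).
  by have := HF0 s => ?; rewrite /eta; der; rewrite addr0.
have etaC : Coo eta.
  by apply: Coo_primitive deta _ => m; apply: CkM; [exact: kC|exact: cpol_Coo].
have etac s : {for s, continuous eta} by exact: Coo_continuous etaC s.
have eta0 s : b <= s -> eta s = 0.
  move=> bs; suff E : F0 b = F0 s by rewrite /eta E subrr.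
  apply: (der_0_cst bs) => y /andP[yb _].
  by apply: der_eq (HF0 y) _; rewrite kr// mul0r.
have etaa s : s <= a -> eta s = eta a.
  move=> sa; suff E : F0 s = F0 a by rewrite /eta E.
  apply: (der_0_cst sa) => y /andP[_ ya].
  by apply: der_eq (HF0 y) _; rewrite kl// mul0r.
have b0 := lt_trans a0 ab; have a1 := lt_trans ab b1.
have b01 : 0 <= b < 1 by rewrite ltW.
have a01 : 0 <= a < 1 by rewrite ltW.
have weak := radial_weak n_gt1 wU cU HG b01 kC dk kr etaC deta eta0 crhs
  (Hweak (radial_test_function b1 etaC eta0)).
pose g1 s := U s * (n%:R * k s + 2 * s * k' s).
pose g2 s := cfactor s ^+ n * (rhs (U s) * eta s).
have cg1 s : s < 1 -> {for s, continuous g1}.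
  move=> s1; apply: continuousM; first exact: cU.
  apply: (@continuousD _ _ _ (fun s => n%:R * k s) (fun s => 2 * s * k' s)).
    by apply: continuousM; [exact: cst_continuous|exact: kc].
  apply: continuousM; last exact: k'c.
  by apply: continuousM; [exact: cst_continuous|exact: cvg_id].
have cg2 s : s < 1 -> {for s, continuous g2}.
  move=> s1; apply: continuousM; first exact/continuousX1/cfactor_continuous.
  by apply: continuousM; [exact: crhs|exact: etac].
(* The term [forcing * eta] integrates the right-hand side by parts: its derivative cancels that of
   the integral of g2 and leaves - forcing cpol k. At a the integral of g2 is forcing a * eta a, and
   at b the tested equation applies, so F vanishes at both ends. *)
exists (fun s => radint n g1 s + radint n g2 s + - (forcing s * eta s)); split.
  move=> s /andP[sa sb].
  have s01 : 0 < s < 1 by rewrite (lt_le_trans a0 sa) (le_lt_trans sb b1).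
  have d1 := radintD cg1 s01; have d2 := radintD cg2 s01.
  have d3 := radintD forcing_integrand_continuous s01; have d4 := deta s.
  have d3' : is_derive s 1 forcing (cfactor s ^+ n * rhs (U s) * (n%:R / (2 * s) * V s)).
    exact: d3.
  der; rewrite /g1 /g2 /A /B; field.
  by case/andP: s01 => s0 _; rewrite gt_eqF.
have r1a : radint n g1 a = 0.
  apply/eqP; rewrite -normr_eq0 eq_le normr_ge0 andbT.
  have := @radint_norm_le R n g1 cg1 a 0 a01; rewrite mul0r; apply.
  by move=> y /andP[_ ya]; rewrite /g1 kl// k'0// !mulr0 addr0 mulr0 normr0.
have r2a : radint n g2 a = forcing a * eta a.
  rewrite /forcing /radint -RintegralZr.
  - apply: eq_Rintegral => t; rewrite inE /ballsq /= => ta.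
    by rewrite /g2 etaa// mulrA.
  - exact: measurable_ballsq.
  - exact: (integrable_radial n forcing_integrand_continuous a01).
have r12b : radint n g1 b + radint n g2 b = 0.
  by apply/eqP; rewrite addr_eq0; apply/eqP; exact: weak.
by rewrite r1a r2a add0r subrr r12b eta0// mulr0 oppr0 addr0.
Qed.

(** Du Bois-Reymond gives (n U V)' = n U V' - forcing cpol without assuming U differentiable;
    dividing n U V by the smooth positive n V then differentiates U, and the terms in V' cancel. *)
Lemma U_derive s : 0 < s < 1 -> is_derive s 1 U
  (- (forcing s * ((1 - s) ^+ (n - 2) / 2 ^+ (n - 1)) / (n%:R * V s))).
Proof.
move=> s01; have /andP[s0 s1] := s01.
have cV y : 0 < y -> {for y, continuous V} by move=> y0; exact: is_derive_cvg (volD y0).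
have cn (y : R) : {for y, continuous (fun _ : R => n%:R : R)} by exact: cst_continuous.
have dA : is_derive s 1 A (B s).
  apply: (@du_bois_reymond R A B 0 1 _ _ AB_test) => // x /andP[x0 x1].
  - exact: (continuousM (continuousM (cn x) (cU x1)) (cV _ x0)).
  - have cM : {for x, continuous forcing}.
      by apply: is_derive_cvg (radintD forcing_integrand_continuous _); rewrite x0.
    have cx : {for x, continuous (fun y : R => n%:R / (2 * y))}.
      apply: continuousM; first exact: cst_continuous.
      apply: continuousV; first by rewrite mulf_neq0// gt_eqF.
      by apply: continuousM; [exact: cst_continuous|exact: cvg_id].
    have h1 : {for x, continuous (fun y : R => n%:R * U y)}.
      exact: (continuousM (cn x) (cU x1)).
    have h2 : {for x, continuous (fun y : R => n%:R / (2 * y) * V y)}.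
      exact: (continuousM cx (cV _ x0)).
    have h3 : {for x, continuous (fun y : R => forcing y * cpol y)}.
      by apply: continuousM => //; exact: Coo_continuous cpol_Coo x.
    exact: (continuousB (continuousM h1 h2) h3).
have Vs := vol_gt0 s0.
apply: (is_derive_near (f := fun y => A y * (n%:R * V y)^-1)).
  exists s => // y; rewrite /ball/= ltr_norml => /andP[_ ys].
  have y0 : 0 < y by move: ys; rewrite ltrBlDr ltrDl.
  have Vy := vol_gt0 y0; rewrite /A; field.
  by rewrite !gt_eqF.
have dV := volD s0.
have nV : n%:R * V s != 0 by rewrite mulf_neq0// gt_eqF.
der => //.
rewrite /A /B /cpol; field.
by rewrite expf_neq0// !gt_eqF.
Qed.

End RadialEquation.

(** * Euclidean radius as a function of hyperbolic distance *)

Section HyperbolicRadius.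
Context {R : realType}.
Implicit Types (x : R).

(** tanh (x / 2), the Euclidean norm of the points at hyperbolic distance x from the origin. *)
Definition hradius x : R := (expR x - 1) / (expR x + 1).

Let expR1_neq0 x : expR x + 1 != 0.
Proof. by rewrite gt_eqF// addr_gt0// expR_gt0. Qed.

Lemma hradius_derive x : is_derive x 1 hradius ((1 - hradius x ^+ 2) / 2).
Proof.
have e1 := expR1_neq0 x; rewrite /hradius; der => //.
by field.
Qed.

Lemma hradius0 : hradius 0 = 0.
Proof. by rewrite /hradius expR0 subrr mul0r. Qed.

Lemma hradius_gt0 x : 0 < x -> 0 < hradius x.
Proof.
by move=> x0; rewrite divr_gt0 ?subr_gt0 ?expR_gt1// addr_gt0// expR_gt0.
Qed.

Lemma hradius_lt1 x : hradius x < 1.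
Proof.
by rewrite ltr_pdivrMr ?addr_gt0 ?expR_gt0// mul1r; move: (expR_gt0 x); lra.
Qed.

Lemma ln_hradius x : ln ((1 + hradius x) / (1 - hradius x)) = x.
Proof.
rewrite -[RHS]expRK; congr ln; have e1 := expR1_neq0 x.
rewrite /hradius; field.
rewrite e1 /=; apply/eqP.
have -> : expR x + 1 - (expR x - 1) = 2 by ring.
by apply/eqP.
Qed.

End HyperbolicRadius.

(** U is read off u along a coordinate axis, at sqrt(s) times a unit vector, so it inherits
    continuity from u, even at s = 0. For s < 0 the square root is 0, which makes U constant
    there. *)
Lemma radial_profile (R : realType) (n : nat) (u : 'rV[R]_n -> R) (v : R -> R) :
  (0 < n)%N ->
  (forall x, uball x -> {for x, continuous u}) ->
  (forall x, uball x -> u x = v (hdist0 x)) ->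
  exists U : R -> R,
    [/\ forall s : R, s < 1 -> {for s, continuous U},
        forall x, uball x -> u x = U (dotp x x) &
        forall r : R, 0 < r -> v r = U (hradius r ^+ 2)].
Proof.
case: n u => // n u _ cu uv.
pose pt (r : R) : 'rV[R]_n.+1 := r *: evec ord0.
have dotp_pt (r : R) : dotp (pt r) (pt r) = r ^+ 2.
  rewrite /dotp (bigD1 ord0)//= big1 ?addr0; first by rewrite !mxE eqxx mulr1 expr2.
  by move=> i /negbTE i0; rewrite !mxE i0 andbF !mulr0.
have enorm_pt (r : R) : 0 <= r -> enorm (pt r) = r.
  by move=> r0; rewrite /enorm dotp_pt sqrtr_sqr ger0_norm.
have pt_ball (s : R) : s < 1 -> uball (pt (Num.sqrt s)).
  move=> s1; apply/uballE; rewrite dotp_pt.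
  by have [s0|s0] := leP 0 s; [rewrite sqr_sqrtr|rewrite ltr0_sqrtr// expr0n].
exists (fun s => u (pt (Num.sqrt s))); split.
- move=> s s1; apply: (@continuous_comp _ _ _ (fun y : R => pt (Num.sqrt y)) u s).
    apply: (@continuous_comp _ _ _ (@Num.sqrt R) pt s); first exact: sqrt_continuous.
    exact: scalel_continuous.
  exact/cu/pt_ball.
- move=> x /[dup] xb /uballE x1.
  rewrite uv// uv; last exact: pt_ball.
  by rewrite /hdist0 enorm_pt// sqrtr_ge0.
- move=> r r0; have h0 := hradius_gt0 r0; have h1 := hradius_lt1 r.
  rewrite sqrtr_sqr gtr0_norm// uv; last first.
    by apply/uballE; rewrite dotp_pt expr_lt1// ltW.
  by rewrite /hdist0 enorm_pt ?ln_hradius// ltW.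
Qed.

(* [v] is the profile of [u] as a function of rho = d(0, x); [u] is the
   continuous representative of the weak solution. *)
Theorem lemma4p6 (R : realType) (N : nat) (theta lambda p : R)
    (u : 'rV[R]_N -> R) (v : R -> R)
    (htheta : 0 < theta)
    (hNp : ((3 <= N)%N /\ 1 < p /\ p <= 2 * N%:R / (N%:R - 2) - 1) \/
           (N = 2%N /\ 1 < p))
    (hH1 : H1 u)
    (hcont : forall x, uball x -> {for x, continuous u})
    (hpos : forall x, uball x -> 0 < u x)
    (hrad : forall x, uball x -> u x = v (hdist0 x))
    (hsol : weak_solution lambda p theta u) :
  (forall rho : R, 0 < rho -> derivable v rho 1 /\ derive1 v rho < 0) /\
  (v rho @[rho --> +oo] --> (0 : R)) /\
  (derive1 v rho @[rho --> +oo] --> (0 : R)).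
Proof.
have N1 : (1 < N)%N by case: hNp => [[N3 _]|[-> //]]; exact: ltn_trans N3.
have p1 : 1 < p by case: hNp => [[_ [//]]|[_ //]].
have N0 : (0 < N)%N := ltnW N1.
have NR : 0 < N%:R :> R by rewrite ltr0n.
have [U [cU uU vU]] := radial_profile N0 hcont hrad.
have [G HG Hweak] := hsol.
pose rhs (c : R) := lambda * c + `|c| `^ (p - 1) * c + theta * c * ln (c ^+ 2).
have rhsE (c : R) : 0 < c -> rhs c = nonlin theta lambda p c.
  move=> c0; rewrite /rhs /nonlin gtr0_norm// lnXn// -mulr_natl; ring.
have Upos (s : R) : 0 <= s -> s < 1 -> 0 < U s.
  move=> s0 s1; pose x : 'rV[R]_N := Num.sqrt s *: evec (Ordinal N0).
  have xs : dotp x x = s.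
    rewrite /dotp (bigD1 (Ordinal N0))//= big1 ?addr0.
      by rewrite !mxE !eqxx mulr1 -expr2 sqr_sqrtr.
    by move=> i /negbTE i0; rewrite !mxE i0 andbF !mulr0.
  have xb : uball x by apply/uballE; rewrite xs.
  by rewrite -xs -uU// hpos.
(* Positivity of U is known only for s >= 0, and [rhs] is shown differentiable only at positive
   values. Freezing U at 0 for negative s gives both everywhere below 1. *)
pose W (s : R) := U (Num.max 0 s).
have cW (s : R) : s < 1 -> {for s, continuous W}.
  move=> s1; apply: (@continuous_comp _ _ _ (fun y : R => Num.max 0 y) U s).
    by apply: continuous_max; [exact: cst_continuous|exact: cvg_id].
  by apply: cU; rewrite gt_max ltr01.
have WE (s : R) : 0 <= s -> W s = U s by move=> s0; rewrite /W (max_idPr s0).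
have Wpos (s : R) : s < 1 -> 0 < W s.
  by move=> s1; apply: Upos; rewrite ?le_max ?lexx// gt_max ltr01.
have uW x : uball x -> u x = W (dotp x x) by move=> xb; rewrite uU// WE// dotp_ge0.
have vW (r : R) : 0 < r -> v r = W (hradius r ^+ 2) by move=> r0; rewrite vU// WE// sqr_ge0.
have crhs (s : R) : s < 1 -> {for s, continuous (fun s => rhs (W s))}.
  move=> s1; apply: (@continuous_comp _ _ _ W rhs s); first exact: cW.
  have W0 := Wpos s s1; have [l dl] := nonlin_derive theta lambda p W0.
  apply: (@is_derive_cvg R rhs (W s) l); apply: is_derive_near dl.
  exists (W s) => // y; rewrite /ball/= ltr_norml => /andP[_ ys].
  by rewrite rhsE//; move: ys; rewrite ltrBlDr ltrDl.
have dW := U_derive N1 uW cW crhs HG Hweak.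
have cF := @forcing_integrand_continuous R N W rhs crhs.
have dM := fun s => @radintD R N N1 _ s cF.
have [B HB] := radial_L2_bound uW cW HG.
have V1 := @vol1_gt0 R N N0.
set c0 := vol N 1 in V1.
have volE (r : R) : 0 < r -> vol N (r ^+ 2) = c0 * r ^+ N.
  by move=> r0; rewrite vol_scale ?exprn_gt0// sqrtr_sqr gtr0_norm.
have h0 := @hradius_gt0 R; have h1 := @hradius_lt1 R.
have T01 (r : R) : 0 < r -> 0 < hradius r ^+ 2 < 1.
  by move=> r0; rewrite exprn_gt0 ?h0//= expr_lt1// ltW// h0.
have dT (r : R) : is_derive r 1 (fun r => hradius r ^+ 2)
    (hradius r * (1 - hradius r ^+ 2)).
  by have dh := hradius_derive r; der; field.
(* N c0 is the area of the unit sphere; dividing by it gives m' = sinh^(N-1) f(v). *)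
pose m (r : R) := forcing W rhs (n := N) (hradius r ^+ 2) / (N%:R * c0).
(* With y = tanh(r/2), sinh r = 2 y / (1 - y^2) and cosh r = (1 + y^2) / (1 - y^2). *)
pose sh (r : R) := (2 * hradius r / (1 - hradius r ^+ 2)) ^+ (N - 1).
pose sh' (r : R) := (N - 1)%:R * (2 * hradius r / (1 - hradius r ^+ 2)) ^+ (N - 1).-1 *
  ((1 + hradius r ^+ 2) / (1 - hradius r ^+ 2)).
(* The powers N and N - 1 are written through N - 2, so that [field] sees a single symbolic
   exponent. *)
have NE : N = (N - 2).+2 by rewrite -addn2 subnK.
have NE1 : (N - 1)%N = (N - 2).+1 by rewrite {1}NE subn1.
have XN (c : R) : c ^+ N = c * (c * c ^+ (N - 2)) by rewrite {1}NE !exprS.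
have XN1 (c : R) : c ^+ (N - 1) = c * c ^+ (N - 2) by rewrite NE1 exprS.
have q0 (r : R) : 0 < r -> 0 < 1 - hradius r ^+ 2.
  by move=> /T01/andP[_]; rewrite subr_gt0.
have Nc0 : 0 < N%:R * c0 by rewrite mulr_gt0.
have dv (r : R) : 0 < r -> is_derive r 1 v (- (m r / sh r)).
  move=> r0; apply: (is_derive_near (f := fun r => W (hradius r ^+ 2))).
    exists r => // y; rewrite /ball/= ltr_norml => /andP[_ ys].
    by rewrite vW//; move: ys; rewrite ltrBlDr ltrDl.
  apply: der_eq (@der_comp R W _ r _ _ (dW _ (T01 r r0)) (dT r)) _.
  rewrite volE ?h0// /m /sh XN !XN1.
  have hr := h0 r r0; have qr := q0 r r0.
  move: (forcing _ _ _) => M; move: (hradius r) hr qr => y hr qr.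
  rewrite !expr_div_n exprMn.
  by field; rewrite !expf_neq0 ?gt_eqF.
have dm (r : R) : 0 < r -> is_derive r 1 m (sh r * nonlin theta lambda p (v r)).
  move=> r0; have hr := h0 r r0; have qr := q0 r r0.
  have dMT := @der_comp R (forcing W rhs (n := N)) _ r _ _ (dM _ (T01 r r0)) (dT r).
  rewrite /m; der.
  rewrite vW// -rhsE; last by apply: Wpos; case/andP: (T01 r r0).
  rewrite volE// /sh /cfactor; move: (forcing _ _ _) => M.
  move: (rhs _) => c; move: (hradius r) hr qr => y hr qr.
  rewrite !XN !XN1 !expr_div_n !exprMn.
  by field; rewrite !expf_neq0 ?gt_eqF.
have dsh (r : R) : 0 < r -> is_derive r 1 sh (sh' r).
  move=> r0; have hr := h0 r r0; have qr := q0 r r0.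
  have dh := hradius_derive r; have dTr := dT r.
  have qN : 1 - hradius r ^+ 2 != 0 by rewrite gt_eqF.
  rewrite /sh /sh'; apply: der_eq.
    by apply: derX; repeat der_step.
  by congr (_ * _); rewrite /GRing.scale/=; field.
have sh_gt0 (r : R) : 0 < r -> 0 < sh r.
  by move=> r0; rewrite exprn_gt0// divr_gt0 ?q0// mulr_gt0// h0.
have sh'_ge0 (r : R) : 0 < r -> 0 <= sh' r.
  move=> r0; have hr := h0 r r0; have qr := q0 r r0.
  apply: mulr_ge0; first apply: mulr_ge0 => //.
    by apply/exprn_ge0/ltW; rewrite divr_gt0// mulr_gt0.
  by rewrite divr_ge0 ?(ltW qr)// addr_ge0// sqr_ge0.
have v_gt0 (r : R) : 0 < r -> 0 < v r.
  by move=> r0; rewrite vW// Wpos//; case/andP: (T01 r r0).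
have T0 (e : R) : 0 < e -> exists2 d : R, 0 < d & forall r : R, 0 < r < d -> hradius r ^+ 2 < e.
  move=> e0; have [d d0 Hd] := continuous_eps (is_derive_cvg (dT 0)) e0.
  exists d => // r /andP[r0 rd]; have := Hd r; rewrite subr0 gtr0_norm// => /(_ rd).
  by rewrite hradius0 expr0n subr0; exact/le_lt_trans/ler_norm.
have v_at0 (e : R) : 0 < e -> exists2 d : R, 0 < d & forall r : R, 0 < r < d -> `|v r - W 0| < e.
  move=> e0; have [d1 d10 H1] := continuous_eps (cW 0 ltr01) e0.
  have [d d0 H2] := T0 _ d10; exists d => // r /[dup] /andP[r0 _] rd.
  by rewrite vW//; apply: H1; rewrite subr0 ger0_norm ?sqr_ge0// H2.
have m_at0 (e : R) : 0 < e -> exists2 d : R, 0 < d & forall r : R, 0 < r < d -> `|m r| < e.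
  move=> e0.
  have half0 : 0 <= 2^-1 :> R by rewrite invr_ge0.
  have [y /andP[_ y1]|C C0 HC] := @bounded_segment R
      (fun s => cfactor s ^+ N * rhs (W s)) 0 2^-1 half0.
    by apply: cF; lra.
  have C1 : 0 < C + 1 by rewrite ltr_wpDl.
  (* The bound 1/2 keeps s in the segment where the integrand is at most C; the square makes the
     radius less than e / (C + 1). The ball volume c0 h^N is then at most c0 h. *)
  have e1 : 0 < Num.min 2^-1 ((e / (C + 1)) ^+ 2).
    by rewrite lt_min invr_gt0 ltr0n exprn_gt0// divr_gt0.
  have [d d0 Hd] := T0 _ e1; exists d => // r /[dup] /andP[r0 _] /Hd.
  rewrite lt_min => /andP[T2 Te].
  have hr := h0 r r0; have hr1 := h1 r.
  have /andP[t0 t1] := T01 r r0.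
  have T01' : 0 <= hradius r ^+ 2 < 1 by rewrite ltW.
  have HM : `|forcing W rhs (n := N) (hradius r ^+ 2)| <= C * (c0 * hradius r ^+ N).
    rewrite -volE//; apply: (@radint_norm_le R N _ cF (hradius r ^+ 2) C T01').
    by move=> y /andP[y0 yT]; apply: HC; rewrite y0 (le_trans yT)// ltW.
  have he : hradius r < e / (C + 1).
    by rewrite -(ltr_pXn2r (n := 2))// nnegrE ltW// divr_gt0.
  rewrite /m normrM normfV (gtr0_norm Nc0) ltr_pdivrMr//.
  apply: le_lt_trans HM _.
  have hN : hradius r ^+ N <= hradius r.
    rewrite XN -[leRHS]mulr1 ler_pM2l// -exprS exprn_ile1// ltW//.
  move: he; rewrite ltr_pdivlMr// => he.
  have N1R : 1 <= N%:R :> R by rewrite ler1n.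
  apply: (@le_lt_trans _ _ (c0 * (C * hradius r))).
    by rewrite mulrCA ler_pM2l// ler_wpM2l.
  have -> : e * (N%:R * c0) = c0 * (e * N%:R) by ring.
  rewrite ltr_pM2l//.
  apply: (@lt_le_trans _ _ e); last by rewrite ler_peMr// ltW.
  by apply: le_lt_trans he; rewrite mulrC ler_pM2l// lerDl.
(* The hyperbolic L^2 mass of u in the ball of radius r, bounded because u is in L^2; its derivative
   is N c0 sinh^(N-1) v^2. *)
pose P (r : R) := radint N (fun s => cfactor s ^+ N * W s ^+ 2) (hradius r ^+ 2).
have cP (s : R) : s < 1 -> {for s, continuous (fun s => cfactor s ^+ N * W s ^+ 2)}.
  move=> s1; apply: continuousM; first exact/continuousX1/cfactor_continuous.
  exact/continuousX1/cW.
have dP (r : R) : 0 < r -> is_derive r 1 P (N%:R * c0 * sh r * v r ^+ 2).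
  move=> r0; have hr := h0 r r0; have qr := q0 r r0.
  apply: der_eq (@der_comp R _ _ r _ _ (radintD N1 cP (T01 r r0)) (dT r)) _.
  rewrite vW// volE// /sh /cfactor; move: (W _) => c.
  move: (hradius r) hr qr => y hr qr.
  rewrite !XN !XN1 !expr_div_n !exprMn.
  by field; rewrite !expf_neq0 ?gt_eqF.
have P_le (r : R) : 0 < r -> P r <= B.
  by move=> r0; apply: HB; case/andP: (T01 r r0) => /ltW -> ->.
have [vneg v_lim v'_lim] := profile_decreasing_vanishing htheta p1 dv dm dsh sh_gt0
  sh'_ge0 v_gt0 (Wpos 0 ltr01) v_at0 m_at0 Nc0 dP P_le.
have v'E (r : R) : 0 < r -> derive1 v r = - (m r / sh r).
  by move=> r0; rewrite derive1E; have [_ ->] := dv r r0.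
split; first by move=> r r0; rewrite v'E//; split; [have [] := dv r r0|exact: vneg].
split => //.
apply: cvg_trans v'_lim; apply: near_eq_cvg; near=> r.
by rewrite v'E//; near: r; apply: nbhs_pinfty_gt; rewrite num_real.
Unshelve. all: by end_near. Qed.
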